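(* Let $\Gamma$ be a discrete subgroup of $\mathrm{SL}_2(\mathbb R)^\sim$, $\Lambda$ a subgroup of $\Gamma$, $\chi:\Gamma\to\mathbb C^\times$ a unitary character, and $m\in\frac12+\mathbb Z_{\geq0}$. Let $f:\mathcal H\to\mathbb C$ be a measurable function such that (f1) $f\big|_m\lambda=\chi(\lambda)f$ for all $\lambda\in\Lambda$; (f2) $\int_{\Lambda\backslash\mathcal H}\left|f(z)\Im(z)^{\frac m2}\right|\,dv(z)<\infty$. Suppose that $\chi\big|_{Z(\Gamma)}=\chi_m\big|_{Z(\Gamma)}$. Then $$\int_{\Gamma\backslash\mathcal H}\left|\left(P_{\Lambda\backslash\Gamma,\chi}f\right)(z)\,\Im(z)^{\frac m2}\right|\,dv(z)>0$$ if there exists a Borel measurable set $S\subseteq\mathcal H$ with the following properties: (S1) If $z_1,z_2\in S$ and $z_1\neq z_2$, then $\Gamma.z_1\neq\Gamma.z_2$. (S2) Writing $(\Lambda.S)^c:=\mathcal H\setminus\Lambda.S$, we have $$\int_{\Lambda\backslash\Lambda.S}\rho\!\left(f(z)\Im(z)^{\frac m2}\right)dv(z)>\int_{\Lambda\backslash(\Lambda.S)^c}\rho\!\left(f(z)\Im(z)^{\frac m2}\right)dv(z)$$ for some measurable function $\rho:\mathbb C\to\mathbb R_{\geq0}$ that satisfies: (M1) $\rho(0)=0$; (M2) $\rho(z)=\rho(|z|)$ for all $z\in\mathbb C$; (M3) $\rho\left(\sum_{n=1}^\infty z_n\right)\leq\sum_{n=1}^\infty\rho(z_n)$ for every sequence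 $(z_n)_{n\in\mathbb Z_{>0}}\subseteq\mathbb C$ with $\sum_{n=1}^\infty|z_n|<\infty$.
   Context: $\mathcal H=\{z\in\mathbb C:\Im(z)>0\}$, and $\mathrm{SL}_2(\mathbb R)$ acts on it by $g.z=\frac{az+b}{cz+d}$ for $g=\begin{pmatrix}a&b\\c&d\end{pmatrix}$. The metaplectic cover $\mathrm{SL}_2(\mathbb R)^\sim$ is the group of pairs $\sigma=(g_\sigma,\eta_\sigma)$ with $g_\sigma=\begin{pmatrix}a_\sigma&b_\sigma\\c_\sigma&d_\sigma\end{pmatrix}\in\mathrm{SL}_2(\mathbb R)$ and $\eta_\sigma:\mathcal H\to\mathbb C$ holomorphic with $\eta_\sigma(z)^2=c_\sigma z+d_\sigma$ for all $z\in\mathcal H$; multiplication is $\sigma_1\sigma_2=(g_{\sigma_1}g_{\sigma_2},\ \eta_{\sigma_1}(g_{\sigma_2}.z)\eta_{\sigma_2}(z))$. It is a connected Lie group for which the projection $\sigma\mapsto g_\sigma$ onto $\mathrm{SL}_2(\mathbb R)$ is a smooth covering homomorphism of degree 2. It acts on $\mathcal H$ by $\sigma.z:=g_\sigma.z$. For $t\in\mathbb R$, $\kappa_t$ denotes the element $\left(\begin{pmatrix}\cos t&-\sin t\\ \sin t&\cos t\end{pmatrix},\eta\right)$ with $\eta(i)=e^{it/2}$. The set $K=\{\kappa_t:t\in\mathbb R\}$ is the stabilizer of $i$, and for $n\in\frac12\mathbb Z$ the character $\chi_n:K\to\mathbb C^\times$ is $\chi_n(\kappa_t)=e^{-int}$.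 The center of $\mathrm{SL}_2(\mathbb R)^\sim$ is $\{\kappa_{n\pi}:n\in\mathbb Z\}\subseteq K$ (cyclic of order 4), and $Z(\Gamma):=\Gamma\cap Z(\mathrm{SL}_2(\mathbb R)^\sim)$. For $m\in\frac12+\mathbb Z_{\ge0}$, $f:\mathcal H\to\mathbb C$ and $\sigma\in\mathrm{SL}_2(\mathbb R)^\sim$: $(f|_m\sigma)(z):=f(g_\sigma.z)\eta_\sigma(z)^{-2m}$ (a right action). $v$ is the $\mathrm{SL}_2(\mathbb R)$-invariant measure $dv(x+iy)=y^{-2}\,dx\,dy$ on $\mathcal H$. For a discrete subgroup $\Delta$ of $\mathrm{SL}_2(\mathbb R)^\sim$ (here $\Delta=\Gamma$ or $\Lambda$), a $\Delta$-invariant set $A\subseteq\mathcal H$ and a $\Delta$-invariant function $\phi$ on $A$, $\int_{\Delta\backslash A}\phi\,dv$ is the integral of $\phi$ over the intersection of $A$ with a Borel fundamental domain for the action of $\Delta$ on $\mathcal H$. The integrands in the claim are invariant under the respective groups. The Poincaré series is $P_{\Lambda\backslash\Gamma,\chi}f:=\sum_{\gamma\in\Lambda\backslash\Gamma}\overline{\chi(\gamma)}\,f|_m\gamma$; under (f1) and (f2) its terms are well-defined and it converges absolutely almost everywhere on $\mathcal H$. *)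

(* Defs.v *)
From HB Require Import structures.
From mathcomp Require Import all_boot all_order all_algebra.
From mathcomp Require Import complex.
From mathcomp Require Import all_classical all_reals all_analysis.
From mathcomp Require Import summability.
From mathcomp Require Import ring.

Set Implicit Arguments.
Unset Strict Implicit.
Unset Printing Implicit Defensive.

Import Order.TTheory GRing.Theory Num.Theory.
Import numFieldNormedType.Exports.

Local Open Scope classical_set_scope.
Local Open Scope complex_scope.
Local Open Scope ring_scope.

(* Complex numbers as a normed space over themselves: this gives R[i] its usual
   topology, and makes [derivable _ z 1] complex differentiability at z. *)
HB.instance Definition _ (R : realType) := NormedModule.copy R[i] R[i]^o.

Section Upper_half_plane.
Variable R : realType.
Implicit Types (g : 'M[R]_2) (z : R[i]).

(* The modulus as an element of R; the norm of R[i] takes its values in R[i]. *)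
Definition cabs z : R := complex.Re `|z|.

Definition uhp : set R[i] := [set z | 0 < complex.Im z].

Definition autom g z : R[i] := (g 1 0)%:C * z + (g 1 1)%:C.

Definition mobius g z : R[i] := ((g 0 0)%:C * z + (g 0 1)%:C) / autom g z.

Lemma uhp_near z : uhp z -> \near z, uhp z.
Proof.
move=> zH; apply/nbhs_normP; exists (complex.Im z)%:C => /=.
  by rewrite ltcR.
move=> w /=; rewrite /uhp /= => h.
have : `|complex.Im (z - w)|%:C < (complex.Im z)%:C.
  apply: le_lt_trans h.
  case: (z - w) => a b /=; rewrite normc_def lecR /=.
  by rewrite -sqrtr_sqr ler_sqrt ?lerDr ?sqr_ge0 // addr_ge0 ?sqr_ge0.
rewrite ltcR => h'; have := le_lt_trans (ler_norm _) h'.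
case: (z) (w) => a b [c d] /=.
by rewrite ltrBlDl -ltrBlDr subrr.
Qed.

Lemma uhp_affine_neq0 (c d : R) z :
  uhp z -> (c != 0) || (d != 0) -> c%:C * z + d%:C != 0.
Proof.
case: z => x y; rewrite /uhp /= => y0 cd; apply/negP => /eqP [].
rewrite !mul0r subr0 addr0 => h1 /eqP.
rewrite addr0 mulf_eq0 (gt_eqF y0) orbF => /eqP c0.
by move: cd h1; rewrite c0 eqxx /= mul0r add0r => /eqP.
Qed.

Lemma det2 g : \det g = g 0 0 * g 1 1 - g 0 1 * g 1 0.
Proof.
rewrite (expand_det_row _ 0) !big_ord_recl big_ord0 addr0 /cofactor !det_mx11.
rewrite !mxE /= expr0 mul1r expr1 mulN1r mulrN.
have e1 (i : 'I_1) : lift (0 : 'I_2) i = 1 by apply/val_inj; rewrite ord1.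
have e0 (i : 'I_1) : lift (1 : 'I_2) i = 0 by apply/val_inj; rewrite ord1.
by rewrite !e1 !e0.
Qed.

Lemma autom_neq0 g z : \det g = 1 -> uhp z -> autom g z != 0.
Proof.
move=> g1 zH; apply: uhp_affine_neq0 => //.
apply/negPn/negP; rewrite negb_or !negbK => /andP[/eqP c0 /eqP d0].
by move/eqP: g1; rewrite det2 c0 d0 !mulr0 subrr eq_sym oner_eq0.
Qed.

Lemma mobius_uhp g z : \det g = 1 -> uhp z -> uhp (mobius g z).
Proof.
move=> g1 zH; have := autom_neq0 g1 zH; move: g1 zH.
rewrite det2 /mobius /autom /uhp /=; case: z => x y /=.
move: (g 0 0) (g 0 1) (g 1 0) (g 1 1) => a b c d g1 y0 n0.
have Dgt0 : 0 < (c * x + d) ^+ 2 + (c * y) ^+ 2.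
  rewrite lt_neqAle addr_ge0 ?sqr_ge0 // andbT eq_sym.
  apply: contra n0; rewrite paddr_eq0 ?sqr_ge0 // !sqrf_eq0.
  move=> /andP[/eqP h1 /eqP h2]; apply/eqP; apply/eqP.
  by rewrite eq_complex /= !mul0r subr0 addr0 h1 h2 addr0 eqxx.
rewrite !(mul0r, addr0, subr0) -/((c * x + d) ^+ 2).
have -> : (a * x + b) * - (c * y / ((c * x + d) ^+ 2 + (c * y) ^+ 2))
   + a * y * ((c * x + d) / ((c * x + d) ^+ 2 + (c * y) ^+ 2))
  = (a * d - b * c) * y / ((c * x + d) ^+ 2 + (c * y) ^+ 2).
  by field; exact: lt0r_neq0.
by rewrite g1 mul1r divr_gt0.
Qed.

Lemma automM g1 g2 z : \det g2 = 1 -> uhp z ->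
  autom (g1 *m g2) z = autom g1 (mobius g2 z) * autom g2 z.
Proof.
move=> d2 zH; have n0 := autom_neq0 d2 zH.
rewrite {1 2}/autom mulrDl -mulrA /mobius divfK //.
rewrite /autom !mxE !big_ord_recl !big_ord0 /= !addr0.
rewrite (_ : lift ord0 ord0 = 1 :> 'I_2); last exact/val_inj.
rewrite (_ : ord0 = 0 :> 'I_2) //.
by rewrite !rmorphD /= !rmorphM /=; ring.
Qed.

Lemma mobiusM g1 g2 z : \det g1 = 1 -> \det g2 = 1 -> uhp z ->
  mobius (g1 *m g2) z = mobius g1 (mobius g2 z).
Proof.
move=> d1 d2 zH; have n0 := autom_neq0 d2 zH.
have n1 := autom_neq0 d1 (mobius_uhp d2 zH).
apply: (mulIf (mulf_neq0 n1 n0)); rewrite -automM // /mobius divfK; last first.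
  by rewrite automM ?mulf_neq0.
rewrite automM // -/(mobius g2 z) mulrA divfK // mulrDl -mulrA /mobius divfK //.
rewrite /autom !mxE !big_ord_recl !big_ord0 /= !addr0.
rewrite (_ : lift ord0 ord0 = 1 :> 'I_2); last exact/val_inj.
rewrite (_ : ord0 = 0 :> 'I_2) //.
by rewrite !rmorphD /= !rmorphM /=; ring.
Qed.

Lemma autom1 z : autom 1%:M z = 1.
Proof. by rewrite /autom !mxE /= mul0r add0r. Qed.

Lemma mobius1 z : mobius 1%:M z = z.
Proof. by rewrite /mobius autom1 !mxE /= mul1r addr0 divr1. Qed.

Lemma derivable_mobius g z : \det g = 1 -> uhp z -> derivable (mobius g) z 1.
Proof.
move=> g1 zH; apply: derivableM.
  apply: derivableD; last exact: derivable_cst.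
  by apply: derivableM; [exact: derivable_cst | exact: derivable_id].
apply: derivableV; first exact: autom_neq0.
apply: derivableD; last exact: derivable_cst.
by apply: derivableM; [exact: derivable_cst | exact: derivable_id].
Qed.

Lemma derivable_compC (f h : R[i] -> R[i]) z :
  derivable h z 1 -> derivable f (h z) 1 -> derivable (f \o h) z 1.
Proof.
move=> /derivable1_diffP dh /derivable1_diffP df.
apply/derivable1_diffP.
exact: (@differentiable_comp R[i] R[i]^o R[i]^o R[i]^o h f z dh df).
Qed.

End Upper_half_plane.

Arguments uhp {R}.

Section Metaplectic.
Variable R : realType.

(* [mp_eta] is a total function on R[i] of which only the restriction to [uhp]
   is meaningful; [mp_etaN] fixes its junk values, so that Leibniz equality on
   [mp] is equality of pairs (g, eta) with eta defined on the upper half-plane. *)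
Record mp := Mp {
  mp_mx : 'M[R]_2;
  mp_eta : R[i] -> R[i];
  mp_det : \det mp_mx = 1;
  mp_eta2 : forall z, uhp z -> mp_eta z ^+ 2 = autom mp_mx z;
  mp_holo : forall z, uhp z -> derivable mp_eta z 1;
  mp_etaN : forall z, ~ uhp z -> mp_eta z = 0 }.

Lemma mp_eq (s t : mp) : mp_mx s = mp_mx t ->
  (forall z, uhp z -> mp_eta s z = mp_eta t z) -> s = t.
Proof.
case: s t => [g e d e2 h n] [g' e' d' e2' h' n'] /= gg' ee'; subst g'.
have ? : e = e'.
  by apply/funext => z; have [/ee'//|zN] := pselect (uhp z); rewrite n ?n'.
by subst e'; congr Mp; exact: Prop_irrelevance.
Qed.

Lemma mp_eta_neq0 (s : mp) z : uhp z -> mp_eta s z != 0.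
Proof.
by move=> zH; rewrite -sqrf_eq0 mp_eta2// autom_neq0 ?mp_det.
Qed.

Definition off0 (e : R[i] -> R[i]) z : R[i] := if `[< uhp z >] then e z else 0.

Lemma off0E e z : uhp z -> off0 e z = e z.
Proof. by rewrite /off0 => /asboolT ->. Qed.

Lemma off0N e z : ~ uhp z -> off0 e z = 0.
Proof. by rewrite /off0 => /asboolF ->. Qed.

Lemma derivable_off0 e z : uhp z -> derivable e z 1 -> derivable (off0 e) z 1.
Proof.
move=> zH; apply: near_eq_derivable.
by near=> w; rewrite off0E//; near: w; exact: uhp_near.
Unshelve. all: by end_near. Qed.

Definition mp_one : mp.
Proof.
refine (@Mp 1%:M (off0 (fun=> 1)) (det1 _ _) _ _ (@off0N _)).
- by move=> z zH; rewrite off0E// expr1n autom1.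
- by move=> z zH; apply: derivable_off0 => //; exact: derivable_cst.
Defined.

Definition mp_mul (s t : mp) : mp.
Proof.
refine (@Mp (mp_mx s *m mp_mx t)
  (off0 (fun z => mp_eta s (mobius (mp_mx t) z) * mp_eta t z)) _ _ _ (@off0N _)).
- by rewrite det_mulmx !mp_det mulr1.
- move=> z zH; have tzH := mobius_uhp (mp_det t) zH.
  by rewrite off0E// exprMn !mp_eta2// automM// mp_det.
- move=> z zH; apply: derivable_off0 => //; apply: derivableM; last exact: mp_holo.
  apply: (@derivable_compC _ (mp_eta s) (mobius (mp_mx t))).
    by apply: derivable_mobius => //; exact: mp_det.
  by apply: mp_holo; apply: mobius_uhp => //; exact: mp_det.
Defined.

Lemma det_invmx2 (g : 'M[R]_2) : \det g = 1 -> \det (invmx g) = 1.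
Proof. by move=> g1; rewrite det_inv g1 invr1. Qed.

Lemma mp_unit (s : mp) : mp_mx s \in unitmx.
Proof. by rewrite unitmxE mp_det unitr1. Qed.

Definition mp_inv (s : mp) : mp.
Proof.
refine (@Mp (invmx (mp_mx s))
  (off0 (fun z => (mp_eta s (mobius (invmx (mp_mx s)) z))^-1)) _ _ _ (@off0N _)).
- exact/det_invmx2/mp_det.
- move=> z zH; have szH := mobius_uhp (det_invmx2 (mp_det s)) zH.
  rewrite off0E// exprVn mp_eta2//.
  have h := automM (mp_mx s) (det_invmx2 (mp_det s)) zH.
  rewrite mulmxV ?mp_unit// autom1 in h.
  apply: (mulfI (autom_neq0 (mp_det s) szH)).
  by rewrite divff ?autom_neq0 ?mp_det// -h.
- move=> z zH; have szH := mobius_uhp (det_invmx2 (mp_det s)) zH.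
  apply: derivable_off0 => //; apply: derivableV; first exact: mp_eta_neq0.
  apply: (@derivable_compC _ (mp_eta s) (mobius (invmx (mp_mx s)))).
    by apply: derivable_mobius => //; exact/det_invmx2/mp_det.
  exact: mp_holo.
Defined.

Lemma mp_mulA : associative mp_mul.
Proof.
move=> s t u; apply: mp_eq => [|z zH]; first exact: mulmxA.
have uzH := mobius_uhp (mp_det u) zH.
by rewrite /= !off0E// mobiusM ?mp_det// mulrA.
Qed.

Lemma mp_mul1 : left_id mp_one mp_mul.
Proof.
move=> s; apply: mp_eq => [|z zH]; first exact: mul1mx.
by rewrite /= !off0E ?mul1r//; apply: mobius_uhp => //; exact: mp_det.
Qed.

Lemma mp_1mul : right_id mp_one mp_mul.
Proof.
move=> s; apply: mp_eq => [|z zH]; first exact: mulmx1.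
by rewrite /= !off0E// mobius1 mulr1.
Qed.

Lemma mp_mulV : left_inverse mp_one mp_inv mp_mul.
Proof.
move=> s; have sH z := @mobius_uhp _ (mp_mx s) z (mp_det s).
apply: mp_eq => [|z zH]; first exact/mulVmx/mp_unit.
rewrite /= !off0E//; last exact: sH.
rewrite -mobiusM ?det_invmx2 ?mp_det// mulVmx ?mp_unit// mobius1.
by rewrite mulVf// mp_eta_neq0.
Qed.

Lemma mp_Vmul : right_inverse mp_one mp_inv mp_mul.
Proof.
move=> s; apply: mp_eq => [|z zH]; first exact/mulmxV/mp_unit.
rewrite /= !off0E// mulfV// mp_eta_neq0//.
by apply: mobius_uhp => //; exact/det_invmx2/mp_det.
Qed.

HB.instance Definition _ := gen_eqMixin mp.
HB.instance Definition _ := gen_choiceMixin mp.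
HB.instance Definition _ := isGroup.Build mp
  mp_mulA mp_mul1 mp_1mul mp_mulV mp_Vmul.

(* Since eta_s is determined by g_s and eta_s(i), the Lie group topology, i.e.
   the one making s |-> g_s a double covering of SL_2(R), is the one induced by
   the injection s |-> (g_s, eta_s(i)). *)
Definition mp_coord (s : mp) : 'M[R]_2 * R[i] := (mp_mx s, mp_eta s 'i%C).
HB.instance Definition _ := Topological.copy mp (initial_topology mp_coord).

End Metaplectic.

Section Subgroups_and_characters.
Variable R : realType.
Implicit Types (G D : set (mp R)) (chi : mp R -> R[i]) (z : R[i]).

Definition mp_subgroup D :=
  [/\ D 1%g, forall s t, D s -> D t -> D (s * t)%g & forall s, D s -> D s^-1%g].

Definition mp_discrete D := forall s, D s -> isolated D s.

Definition mp_center : set (mp R) := [set s | forall t, (s * t = t * s)%g].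

Definition expi (t : R) : R[i] := cos t +i* sin t.

Definition is_kappa (t : R) (s : mp R) :=
  mp_mx s = \matrix_(i, j) (if i == j then cos t
                            else if i == 0 then - sin t else sin t)
  /\ mp_eta s 'i%C = expi (t / 2).

(* Unitary characters of G; the values of chi off G are irrelevant. *)
Definition unitary_character G chi :=
  (forall s t, G s -> G t -> chi (s * t)%g = chi s * chi t) /\
  (forall s, G s -> `|chi s| = 1).

(* chi and chi_n : kappa_t |-> e^(-int) agree on Z(G) *)
Definition central_character G chi (n : R) :=
  forall s t, G s -> mp_center s -> is_kappa t s -> chi s = expi (- (n * t)).

Definition mp_act (s : mp R) z := mobius (mp_mx s) z.

Definition mp_orbit D z : set R[i] := [set mp_act s z | s in D].

Definition mp_saturation D (A : set R[i]) : set R[i] :=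
  \bigcup_(z in A) mp_orbit D z.

(* The weights are the half-integers m = k + 1/2, and are given by k. *)
Definition weight (k : nat) : R := k%:R + 2^-1.

(* f|_m s; the exponent is -2m = -(2k+1) *)
Definition slash (k : nat) (f : R[i] -> R[i]) (s : mp R) z : R[i] :=
  f (mp_act s z) * mp_eta s z ^- (2 * k + 1).

Definition mp_rcosets D G : set (set (mp R)) :=
  [set [set (l * s)%g | l in D] | s in G].

(* Each term is computed on a representative of the coset; [summability.sum] is
   the unordered sum, i.e. the limit along the finite subsets of [mp_rcosets D G]. *)
Definition poincare (k : nat) D G chi f z : R[i] :=
  summability.sum (fun c : mp_rcosets D G => let s := xget 1%g (val c) in
    (chi s)^* * slash k f s z).

End Subgroups_and_characters.

Section Hyperbolic_measure.
Variable R : realType.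
Implicit Types (A F : set R[i]) (D : set (mp R)).
Let mu := @lebesgue_measure R.

Definition toC (p : R * R) : R[i] := p.1 +i* p.2.

(* Borel sets and functions on C, through the identification [toC] of R^2
   with C *)
Definition borelC A := measurable (toC @^-1` A).

Definition borel_funC A (f : R[i] -> R[i]) :=
  measurable_fun (toC @^-1` A) (fun p => complex.Re (f (toC p))) /\
  measurable_fun (toC @^-1` A) (fun p => complex.Im (f (toC p))).

Definition borel_funCR (rho : R[i] -> R) :=
  measurable_fun setT (fun p => rho (toC p)).

(* Integral over A of phi >= 0 with respect to dv = y^-2 dx dy *)
Definition hint A (phi : R[i] -> R) : \bar R :=
  (\int[mu \x mu]_(p in toC @^-1` A) (phi (toC p) * p.2 ^- 2)%:E)%E.

(* v-null sets; the same as the Lebesgue null subsets of uhp *)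
Definition hnull A := (mu \x mu)%E.-negligible (toC @^-1` A).

(* Borel fundamental domains: the translates of F cover uhp up to a null set,
   and F meets gF in a null set unless g acts trivially on uhp (as the elements
   of D above +1 and -1 do). Borel sets of representatives of D\uhp are the
   special case where F meets every orbit exactly once. *)
Definition fundamental_domain D F :=
  [/\ F `<=` uhp, borelC F,
      hnull (uhp `\` mp_saturation D F) &
      forall s, D s -> (exists2 z, uhp z & mp_act s z != z) ->
        hnull (F `&` mp_act s @` F)].

(* \int_(D\A) phi dv, computed with the fundamental domain F for D *)
Definition qint F A (phi : R[i] -> R) : \bar R := hint (A `&` F) phi.

(* z |-> f(z) Im(z)^(m/2) *)
Definition normalized (k : nat) (f : R[i] -> R[i]) (z : R[i]) : R[i] :=
  f z * (complex.Im z `^ (weight R k / 2))%:C.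

End Hyperbolic_measure.

(* Main.v *)
Require Import Defs.
From HB Require Import structures.
From mathcomp Require Import all_boot all_order all_algebra finmap.
From mathcomp Require Import complex.
From mathcomp Require Import all_classical all_reals all_analysis.
From mathcomp Require Import measurable_realfun summability ring lra.

Set Implicit Arguments.
Unset Strict Implicit.
Unset Printing Implicit Defensive.

Import Order.TTheory GRing.Theory Num.Theory.
Import numFieldNormedType.Exports.

Local Open Scope classical_set_scope.
Local Open Scope complex_scope.
Local Open Scope ring_scope.

(* Suppose that the integral of |P f| Im^(m/2) vanishes. Then P f = 0
   almost everywhere where its defining series converges absolutely; by unfolding
   and (f2) this is the case almost everywhere on S. For generic z in S the terms
   of P f come in blocks of constant size, indexed by Lambda Z(Gamma) \ Gamma,
   the hypothesis on chi making them constant on each block; so f(z) is minus the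
   sum of one term for each nontrivial class. The properties of rho then bound
   rho(f(z) Im(z)^(m/2)) by the sum of its values at the points gamma z of these
   classes, which by (S1) lie outside Lambda S. Integrating over S and unfolding
   gives the inequality opposite to (S2).

   Invariance of dv under SL_2(R): in the coordinates u = x / y, t = ln y it is
   du dt, and the generators (translations, dilations, inversion) act by shears
   and reflections. *)

(** * Densities and one-dimensional substitutions *)

(** Fundamental domains are controlled only up to null sets, while counting the terms of P f
    requires exact statements. Gamma being countable, all exceptional points lie in one
    Gamma-invariant null set. At any other point p, every class of Lambda Z(Gamma) \ Gamma contains
    exactly one least representative, in a fixed enumeration of Gamma, that moves p into the domain
    [FL] of Lambda. Cutting f to [FL] thus turns the sum over cosets into a series over a fixed
    sequence whose terms depend measurably on p, and every unfolding becomes a statement about a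
    sequence of disjoint translates.

    A second obstacle is that [poincare] is a limit with an arbitrary value where the sum does not
    converge. Its measurability and the invariance of its normalized modulus are available only from
    points of absolute convergence, so its integral over [FG] is bounded below by monotonicity,
    without measurability of the larger function. *)

Section density.
Local Open Scope ereal_scope.
Context d (T : measurableType d) (R : realType) (mu : {measure set T -> \bar R}).
Variable w : T -> R.

(** The proofs are arguments so that the measure structure can be inferred from the term itself. *)
Definition density (mw : measurable_fun setT w) (w0 : forall x, (0 <= w x)%R)
  (A : set T) : \bar R := \int[mu]_(x in A) (w x)%:E.

Hypotheses (mw : measurable_fun setT w) (w0 : forall x, (0 <= w x)%R).

Let mwe D : measurable_fun D (fun x => (w x)%:E).
Proof. by apply/measurable_EFinP; exact: measurable_funTS. Qed.

Let density0 : density mw w0 set0 = 0.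
Proof. exact: integral_set0. Qed.

Let density_ge0 A : 0 <= density mw w0 A.
Proof. by apply: integral_ge0 => x _; rewrite lee_fin. Qed.

Let density_sigma_additive : semi_sigma_additive (density mw w0).
Proof.
move=> F mF tF mUF; rewrite /density ge0_integral_bigcup//; last first.
  by move=> x _; rewrite lee_fin.
apply: is_cvg_nneseries => n _ _; exact: density_ge0.
Qed.

HB.instance Definition _ := isMeasure.Build _ _ _ (density mw w0)
  density0 density_ge0 density_sigma_additive.

Import HBNNSimple.

(** Monotone convergence along simple functions, applied to both sides, reduces the identity to
    indicator functions, where it is the definition of [density]. *)
Lemma ge0_integral_density D (f : T -> \bar R) : measurable D ->
  measurable_fun D f -> (forall x, D x -> 0 <= f x) ->
  \int[density mw w0]_(x in D) f x = \int[mu]_(x in D) (f x * (w x)%:E).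
Proof.
move=> mE mf f0; set E := D in mE mf f0 *; set nu := density mw w0.
pose h := nnsfun_approx mE mf.
have -> : \int[nu]_(x in E) f x =
    lim (\int[nu]_(x in E) (EFin \o h n) x @[n --> \oo]).
  have fE x : E x -> f x = lim ((EFin \o h n) x @[n --> \oo]).
    by move=> Ex; apply/esym/cvg_lim => //; exact: cvg_nnsfun_approx.
  under eq_integral => x /[!inE] /fE -> //.
  apply: monotone_convergence => //.
  - by move=> n; apply/measurable_EFinP; by apply: (measurable_funS measurableT) => //; exact/measurable_funP.
  - by move=> n x Ex //=; rewrite lee_fin.
  - by move=> x Ex a b ab; rewrite lee_fin; exact/lefP/nd_nnsfun_approx.
have -> : \int[mu]_(x in E) (f x * (w x)%:E) =
    lim (\int[mu]_(x in E) ((h n x)%:E * (w x)%:E) @[n --> \oo]).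
  have fg x : E x -> f x * (w x)%:E = lim ((h n x)%:E * (w x)%:E @[n --> \oo]).
    by move=> Ex; apply/esym/cvg_lim => //; apply: cvgeZr => //; exact: cvg_nnsfun_approx.
  under eq_integral => x /[!inE] /fg -> //.
  apply: monotone_convergence => [//| | |].
  - by move=> n; apply/emeasurable_funM => //; apply/measurable_EFinP; by apply: (measurable_funS measurableT) => //; exact/measurable_funP.
  - by move=> n x Ex /=; rewrite mule_ge0 ?lee_fin.
  - move=> x Ex a b ab/=; rewrite lee_wpmul2r ?lee_fin//.
    exact/lefP/nd_nnsfun_approx.
congr (limn _); apply/funext => n /=.
transitivity (\int[nu]_(x in E)
   (\sum_(y \in range (h n)) (y * \1_(h n @^-1` [set y]) x)%:E)).
  by apply: eq_integral => t tE; rewrite /= fimfunE -fsumEFin.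
have indich m r : measurable_fun E (fun x => (r * \1_(h m @^-1` [set r]) x)%:E).
  by apply: (measurable_comp measurableT) => //; exact: measurable_funM.
rewrite ge0_integral_fsum//; last by move=> m y Ey; exact: nnfun_muleindic_ge0.
transitivity (\int[mu]_(x in E) (\sum_(y \in range (h n))
    (y * \1_(h n @^-1` [set y]) x)%:E * (w x)%:E)); last first.
  apply: eq_integral => x xE.
  rewrite -ge0_mule_fsuml => [|y]; last exact: nnfun_muleindic_ge0.
  by rewrite fsumEFin // -(fimfunE _ x).
rewrite ge0_integral_fsum//; last 2 first.
  - by move=> y; apply: emeasurable_funM.
  - by move=> m y Ey; apply: mule_ge0; [exact: nnfun_muleindic_ge0|rewrite lee_fin].
apply: eq_fsbigr => r rhn.
under eq_integral do rewrite EFinM.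
rewrite integralZl_indic_nnsfun => //.
under [RHS]eq_integral do rewrite EFinM -muleA.
rewrite ge0_integralZl//.
- under [in RHS]eq_integral do rewrite muleC.
  rewrite [in RHS](eq_integral ((EFin \o w) \_ (h n @^-1` [set r]))); last first.
    by move=> x xE; rewrite epatch_indic.
  by rewrite -integral_mkcondr integral_indic// /nu /= /density setIC.
- by apply: emeasurable_funM => //; apply/measurable_EFinP.
- by move=> t Et; rewrite mule_ge0 ?lee_fin.
- by move: rhn; rewrite inE => -[t _ <-]; rewrite lee_fin.
Qed.

End density.

Section lebesgue_substitution.
Local Open Scope ereal_scope.
Variable R : realType.
Notation mu := (@lebesgue_measure R).
Implicit Types f : R -> \bar R.

(** Lebesgue measure is determined by its values on half-open intervals, so the push-forward of [m]
    is Lebesgue measure. The substitutions below are instances of this. *)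
Lemma ge0_integral_lebesgue_pushforward
    (m : {measure set (measurableTypeR R) -> \bar R})
    (phi : measurableTypeR R -> measurableTypeR R)
    (mphi : measurable_fun setT phi) f :
  (forall a b, (a < b)%R -> m (phi @^-1` `]a, b]) = (b - a)%:E) ->
  measurable_fun setT f -> (forall x, 0 <= f x) ->
  \int[mu]_x f x = \int[m]_x f (phi x).
Proof.
move=> mab mf f0.
transitivity (\int[pushforward m phi]_x f x); last first.
  by rewrite ge0_integral_pushforward// preimage_setT.
apply: eq_measure_integral => A mA _.
apply: lebesgue_measure_unique => // _ [[a b]] _ <- /=.
rewrite /pushforward; have [ab|ba] := ltP a b.
  by rewrite mab// lebesgue_measure_itv/= lte_fin ab.
by rewrite set_itv_ge ?bnd_simp -?leNgt// preimage_set0 !measure0.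
Qed.

Lemma ge0_integral_lebesgueD f c : measurable_fun setT f -> (forall x, 0 <= f x) ->
  \int[mu]_x f (x + c)%R = \int[mu]_x f x.
Proof.
move=> mf f0; apply/esym/(@ge0_integral_lebesgue_pushforward _ (fun x => x + c)%R) => //.
  exact: measurable_funD.
move=> a b ab; rewrite (_ : _ @^-1` _ = `]a - c, b - c]%classic)%R; last first.
  by apply/seteqP; split=> x /=; rewrite !in_itv/= ltrBlDr lerBrDr.
by rewrite /= lebesgue_measure_itv/= lte_fin ltrD2r ab -EFinD; congr (_%:E); lra.
Qed.

Lemma ge0_integral_lebesgueN f : measurable_fun setT f -> (forall x, 0 <= f x) ->
  \int[mu]_x f (- x)%R = \int[mu]_x f x.
Proof.
move=> mf f0; apply/esym/(@ge0_integral_lebesgue_pushforward _ -%R) => //.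
move=> a b ab; rewrite opp_preimage_itvbndbnd/=.
by rewrite /= lebesgue_measure_itv/= lte_fin ltrN2 ab -EFinD; congr (_%:E); lra.
Qed.

Lemma ge0_integral_lebesgueM f c : (0 < c)%R ->
  measurable_fun setT f -> (forall x, 0 <= f x) ->
  c%:E * \int[mu]_x f (x * c)%R = \int[mu]_x f x.
Proof.
move=> c0 mf f0; pose c' := NngNum (ltW c0).
rewrite (@ge0_integral_lebesgue_pushforward (mscale c' mu) (fun x => x * c)%R _ f)//.
- rewrite ge0_integral_mscale//.
  by apply: measurableT_comp => //; exact: measurable_funM.
- exact: measurable_funM.
- move=> a b ab; rewrite (_ : _ @^-1` _ = `]a / c, b / c]%classic)%R; last first.
    by apply/seteqP; split=> x /=; rewrite !in_itv/= ltr_pdivrMr// ler_pdivlMr.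
  rewrite /= /mscale /= lebesgue_measure_itv/= lte_fin ltr_pM2r ?invr_gt0// ab.
  by rewrite -EFinD -EFinM; congr (_%:E); field; rewrite gt_eqF.
Qed.

(** The density of dy/y on the positive half-line; the cut at 0 keeps it non-negative. *)
Let w (y : R) : R := if (0 < y)%R then (y^-1)%R else 0%R.

Lemma measurable_inv : measurable_fun setT (fun x : R => x^-1)%R.
Proof.
rewrite -(setUv [set 0%R]); apply/measurable_funU => //; first exact: measurableC.
split; first exact: measurable_fun_set1.
apply: open_continuous_measurable_fun.
  exact/closed_openC/closed_eq.
by move=> x; rewrite inE/= => /eqP x0; exact: inv_continuous.
Qed.

Let mw : measurable_fun setT w.
Proof.
apply: measurable_fun_ifT => //=; first exact: measurable_fun_ltr.
exact: measurable_inv.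
Qed.

Let w0 y : (0 <= w y)%R.
Proof. by rewrite /w; case: ifPn => // /ltW; rewrite invr_ge0. Qed.

(** The map [ln] carries dy/y to Lebesgue measure, since the integral of 1/y from e^a to e^b is b -
    a. The density vanishes for y <= 0, so the default value of [ln] there does no harm. *)
Lemma ge0_integral_lebesgue_expR f :
  measurable_fun setT f -> (forall x, 0 <= f x) ->
  \int[mu]_x f (expR x) = \int[mu]_x (f x * (if 0 < x then x^-1 else 0)%R%:E).
Proof.
move=> mf f0; pose m := density mu mw w0.
rewrite (@ge0_integral_lebesgue_pushforward m (@ln R) (@measurable_ln R) (f \o expR))//.
- rewrite ge0_integral_density//.
    apply: eq_integral => y _; rewrite /w; case: ifPn => [y0|]; last by rewrite !mule0.
    by rewrite /= lnK ?posrE.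
  + by do 2 apply: measurableT_comp => //; exact: measurable_ln.
  + by move=> x _ /=.
- move=> a b ab; rewrite /m /= /density /=.
  have eab : (expR a < expR b)%R by rewrite ltr_expR.
  have gt0 x : (expR a <= x)%R -> (0 < x)%R by apply: lt_le_trans; exact: expR_gt0.
  rewrite (_ : \int[mu]_(x in _) _ =
      \int[mu]_(y in `[expR a, expR b]) (y^-1)%R%:E).
    rewrite (@continuous_FTC2 _ _ (@ln R))//.
    + by rewrite !expRK.
    + apply: continuous_in_subspaceT => x; rewrite inE/= in_itv/= => /andP[/gt0 x0 _].
      by apply: inv_continuous; rewrite gt_eqF.
    + split.
      * move=> x; rewrite in_itv/= => /andP[/ltW/gt0 x0 _].
        by apply: ex_derive; exact: is_derive1_ln.
      * by apply: cvg_at_right_filter; exact/continuous_ln/gt0.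
      * by apply: cvg_at_left_filter; exact/continuous_ln/gt0/ltW.
    + move=> x; rewrite in_itv/= => /andP[/ltW/gt0 x0 _].
      by rewrite derive1E; apply: derive_val; exact: is_derive1_ln.
  rewrite -integral_itv_obnd_cbnd; last first.
    by apply/measurable_EFinP; apply: measurable_funTS; exact: measurable_inv.
  rewrite integral_mkcond [RHS]integral_mkcond; apply: eq_integral => y _.
  rewrite !patchE /w; have [y0|y0] := ltP 0%R y.
    congr (if _ then _ else _); apply/idP/idP; rewrite !inE/= !in_itv/=.
      by move=> /andP[a1 b1]; rewrite -[y]lnK// ltr_expR ler_expR a1.
    by move=> /andP[a1 b1]; rewrite -ltr_expR -(ler_expR _ b) lnK ?posrE// a1.
  have -> : (y \in `]expR a, expR b]%classic) = false.
    by apply/negP; rewrite inE/= in_itv/= => /andP[/ltW/gt0]; rewrite ltNge y0.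
  by case: ifP.
- by apply: measurableT_comp => //; exact: measurable_expR.
- by move=> x /=.
Qed.
End lebesgue_substitution.

(** * The hyperbolic measure and its invariance *)

Section hyperbolic_measure.
Local Open Scope ereal_scope.
Variable R : realType.
Notation mu := (@lebesgue_measure R).

Definition half_plane : set (R * R) := [set p | 0 < p.2]%R.

Lemma measurable_half_plane : measurable half_plane.
Proof.
rewrite (_ : half_plane = setT `&` (fun p : R * R => p.2) @^-1` `]0%R, +oo[).
  exact: measurable_snd.
by apply/seteqP; split=> p; rewrite /half_plane/= in_itv/= andbT => // -[].
Qed.

(** Zero off the half-plane, so that [hmeas] is a measure on all of R * R carried by the
    half-plane. *)
Definition hweight (p : R * R) : R := if (0 < p.2)%R then (p.2 ^- 2)%R else 0%R.

Lemma measurable_hweight : measurable_fun setT hweight.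
Proof.
apply: measurable_fun_ifT => //=.
  by apply: measurable_fun_ltr => //; exact: measurable_snd.
apply: measurableT_comp; first exact: measurable_inv.
by apply: measurable_funX; exact: measurable_snd.
Qed.

Lemma hweight_ge0 p : (0 <= hweight p)%R.
Proof. by rewrite /hweight; case: ifPn => // p0; rewrite invr_ge0 exprn_ge0// ltW. Qed.

Definition hmeas := density (mu \x mu) measurable_hweight hweight_ge0.
HB.instance Definition _ := Measure.on hmeas.

Implicit Types th : R * R -> \bar R.

Lemma measurable_fun_pairM : measurable_fun setT (fun p : R * R => (p.1 * p.2, p.2)%R).
Proof.
apply: measurable_fun_pair; last exact: measurable_snd.
by apply: measurable_funM; [exact: measurable_fst|exact: measurable_snd].
Qed.

Definition hpolar (p : R * R) : R * R := (p.1 * expR p.2, expR p.2)%R.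

Lemma measurable_hpolar : measurable_fun setT hpolar.
Proof.
apply: measurable_fun_pair; last first.
  by apply: measurableT_comp => //; exact: measurable_snd.
apply: measurable_funM; first exact: measurable_fst.
by apply: measurableT_comp => //; exact: measurable_snd.
Qed.

(* In the coordinates u = x / y and t = ln y the hyperbolic measure is du dt. *)
Lemma ge0_integral_hmeas th : measurable_fun setT th -> (forall p, 0 <= th p) ->
  \int[hmeas]_p th p = \int[mu \x mu]_p th (hpolar p).
Proof.
move=> mth th0; rewrite ge0_integral_density//.
rewrite fubini_tonelli2; last 2 first.
- apply: emeasurable_funM => //; apply/measurable_EFinP; exact: measurable_hweight.
- by move=> p; rewrite mule_ge0// lee_fin hweight_ge0.
rewrite fubini_tonelli2; last 2 first.
- by apply: measurableT_comp => //; exact: measurable_hpolar.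
- by [].
rewrite /fubini_G/=.
have mth' := measurableT_comp mth measurable_fun_pairM.
(* The weight y^-2 splits: one factor 1/y comes from y = e^t, the other from x = u y at fixed y. *)
pose F y := \int[mu]_u th (u * y, y)%R.
transitivity (\int[mu]_y F (expR y)); last by [].
rewrite ge0_integral_lebesgue_expR//; last 2 first.
- by apply: (measurable_fun_fubini_tonelli_G (m1 := mu) _ mth') => p; exact: th0.
- by move=> y; exact: integral_ge0.
apply: eq_integral => y _.
have mthy : measurable_fun setT (fun x => th (x, y)).
  by apply: measurableT_comp => //; exact: pair2_measurable.
rewrite /hweight/= ge0_integralZr//; last first.
  by rewrite lee_fin; exact: (hweight_ge0 (0%R, y)).
case: ifPn => [y0|_]; last by rewrite !mule0.
rewrite -(ge0_integral_lebesgueM y0 mthy)// muleC muleA -EFinM muleC.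
by congr (_ * _%:E); rewrite expr2; field; rewrite gt_eqF.
Qed.

Lemma ge0_integral_hmeas_ut th : measurable_fun setT th -> (forall p, 0 <= th p) ->
  \int[hmeas]_p th p = \int[mu]_t \int[mu]_u th (hpolar (u, t)).
Proof.
move=> mth th0; rewrite ge0_integral_hmeas//.
exact: (@fubini_tonelli2 _ _ _ _ R mu mu (th \o hpolar) (measurableT_comp mth measurable_hpolar) (fun=> th0 _)).
Qed.

Lemma ge0_integral_hmeas_tu th : measurable_fun setT th -> (forall p, 0 <= th p) ->
  \int[hmeas]_p th p = \int[mu]_u \int[mu]_t th (hpolar (u, t)).
Proof.
move=> mth th0; rewrite ge0_integral_hmeas//.
exact: (@fubini_tonelli1 _ _ _ _ R mu mu (th \o hpolar) (measurableT_comp mth measurable_hpolar) (fun=> th0 _)).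
Qed.

Definition hmeas_preserving (g : R * R -> R * R) := measurable_fun setT g /\
  forall th, measurable_fun setT th -> (forall p, 0 <= th p) ->
    \int[hmeas]_p th (g p) = \int[hmeas]_p th p.

Lemma hmeas_preserving_comp g h :
  hmeas_preserving g -> hmeas_preserving h -> hmeas_preserving (g \o h).
Proof.
move=> [mg ig] [mh ih]; split=> [|th mth th0]; first exact: measurableT_comp.
by rewrite (ih (th \o g) (measurableT_comp mth mg) (fun p => th0 _)) ig.
Qed.

(** At fixed t this is the translation of u by b e^(-t). *)
Lemma hmeas_preserving_translation (b : R) :
  hmeas_preserving (fun p => (p.1 + b, p.2)%R).
Proof.
have mg : measurable_fun setT (fun p : R * R => (p.1 + b, p.2)%R).
  apply: measurable_fun_pair; last exact: measurable_snd.
  by apply: measurable_funD => //; exact: measurable_fst.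
split=> // th mth th0; have mthp := measurableT_comp mth measurable_hpolar.
rewrite (ge0_integral_hmeas_ut (measurableT_comp mth mg) (fun=> th0 _)).
rewrite [RHS](ge0_integral_hmeas_ut mth th0); apply: eq_integral => t _ /=.
rewrite -[RHS](ge0_integral_lebesgueD (b * expR (- t))%R)//; last first.
  exact: (measurableT_comp mthp (pair2_measurable _)).
apply: eq_integral => u _; rewrite /hpolar/= mulrDl -mulrA -expRD.
by rewrite addNr expR0 mulr1.
Qed.

Lemma hmeas_preserving_scaling (a : R) : (0 < a)%R ->
  hmeas_preserving (fun p => (a * p.1, a * p.2)%R).
Proof.
move=> a0; have mg : measurable_fun setT (fun p : R * R => (a * p.1, a * p.2)%R).
  by apply: measurable_fun_pair; apply: measurable_funM => //.
split=> // th mth th0; have mthp := measurableT_comp mth measurable_hpolar.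
rewrite (ge0_integral_hmeas_tu (measurableT_comp mth mg) (fun=> th0 _)).
rewrite [RHS](ge0_integral_hmeas_tu mth th0); apply: eq_integral => u _ /=.
rewrite -[RHS](ge0_integral_lebesgueD (ln a))//; last first.
  exact: (measurableT_comp mthp (pair1_measurable _)).
apply: eq_integral => t _; rewrite /hpolar/= expRD lnK ?posrE//.
by congr (th (_, _)); ring.
Qed.

(** This is z |-> -1/z. As x^2 + y^2 = e^(2t) (1 + u^2), it sends (u, t) to (-u, -t - ln (1 + u^2)):
    a reflection in u and, at fixed u, a reflection and a translation in t. *)
Lemma hmeas_preserving_inversion :
  hmeas_preserving (fun p => (- p.1 / (p.1 ^+ 2 + p.2 ^+ 2), p.2 / (p.1 ^+ 2 + p.2 ^+ 2))%R).
Proof.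
set g := fun p => _; have mg : measurable_fun setT g.
  have m12 : measurable_fun setT (fun p : R * R => (p.1 ^+ 2 + p.2 ^+ 2)^-1)%R.
    apply: measurableT_comp; first exact: measurable_inv.
    by apply: measurable_funD; apply: measurable_funX; [exact: measurable_fst|exact: measurable_snd].
  apply: measurable_fun_pair; apply: measurable_funM => //.
  by apply: measurable_funN; exact: measurable_fst.
split=> // th mth th0; have mthp := measurableT_comp mth measurable_hpolar.
rewrite (ge0_integral_hmeas_tu (measurableT_comp mth mg) (fun=> th0 _)).
transitivity (\int[mu]_u \int[mu]_t th (hpolar (- u, t)%R)); last first.
  rewrite [RHS](ge0_integral_hmeas_tu mth th0).
  pose F u := \int[mu]_t th (hpolar (u, t)).
  have mF : measurable_fun setT F.
    by apply: (measurable_fun_fubini_tonelli_F (m2 := mu) _ mthp) => p; exact: th0.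
  by apply: (ge0_integral_lebesgueN (f := F)) => // u; exact: integral_ge0.
apply: eq_integral => u _ /=.
have u1 : (0 < 1 + u ^+ 2)%R by rewrite ltr_wpDr// sqr_ge0.
set f := fun t => th (hpolar (- u, t)%R).
have mf : measurable_fun setT f by exact: (measurableT_comp mthp (pair1_measurable _)).
rewrite -[RHS]ge0_integral_lebesgueN//.
rewrite -[RHS](ge0_integral_lebesgueD (ln (1 + u ^+ 2)))//; last first.
  have mfN : measurable_fun setT (f \o -%R) by apply: measurableT_comp mf _; exact: oppr_measurable.
  exact: mfN.
apply: eq_integral => t _; rewrite /f /hpolar /g /= opprD expRD !expRN lnK ?posrE//.
have e0 := expR_gt0 t.
have u0 : (1 + u ^+ 2 != 0)%R by rewrite gt_eqF.
have e1 : (expR t != 0)%R by rewrite gt_eqF.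
have -> : ((u * expR t) ^+ 2 + expR t ^+ 2 = expR t ^+ 2 * (1 + u ^+ 2))%R by ring.
by congr (th (_, _)); field; rewrite u0 e1.
Qed.

End hyperbolic_measure.

Section monotone.
Local Open Scope ereal_scope.
Context d (T : measurableType d) (R : realType) (mu : {measure set T -> \bar R}).

(* Unlike [ge0_le_integral], the larger function need not be measurable. *)
Lemma ge0_le_integral_nonmeasurable (D : set T) (f g : T -> \bar R) :
  (forall x, D x -> 0 <= f x) -> (forall x, D x -> f x <= g x) ->
  \int[mu]_(x in D) f x <= \int[mu]_(x in D) g x.
Proof.
move=> f0 fg; rewrite !(integral_mkcond D).
have fg' x : (f \_ D) x <= (g \_ D) x.
  by rewrite !patchE; case: ifPn => // /set_mem /fg.
have f0' x : 0 <= (f \_ D) x.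
  by rewrite patchE; case: ifPn => // /set_mem /f0.
rewrite !ge0_integralTE// => [|x]; last exact: le_trans (fg' x).
apply: ereal_sup_le => _ [h hf <-]; exists h => // x.
exact: le_trans (hf x) (fg' x).
Qed.

End monotone.

(** * The action in real coordinates and the invariance of the hyperbolic measure *)

Section action_on_pairs.
Variable R : realType.
Implicit Types (p : R * R) (s t : mp R).

Definition ofC (z : R[i]) : R * R := (complex.Re z, complex.Im z).

Lemma toCK : cancel (@toC R) ofC. Proof. by case. Qed.
Lemma ofCK : cancel ofC (@toC R). Proof. by case. Qed.

Lemma uhp_toC p : uhp (toC p) = half_plane p.
Proof. by []. Qed.

(* The identity off the half-plane, so that hact is a group action on all of R * R. *)
Definition hact s p : R * R :=
  if 0 < p.2 then ofC (mp_act s (toC p)) else p.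

Lemma hactE s p : half_plane p -> hact s p = ofC (mp_act s (toC p)).
Proof. by rewrite /half_plane/= /hact => ->. Qed.

Lemma toC_hact s p : half_plane p -> toC (hact s p) = mp_act s (toC p).
Proof. by move=> p0; rewrite hactE// ofCK. Qed.

Lemma hact_half_plane s p : half_plane p -> half_plane (hact s p).
Proof.
by move=> p0; rewrite -uhp_toC toC_hact//; apply: mobius_uhp => //; exact: mp_det.
Qed.

Lemma hactN s p : ~ half_plane p -> hact s p = p.
Proof. by move=> /negP/negbTE; rewrite /hact => ->. Qed.

Lemma mp_actM s t (z : R[i]) : uhp z -> mp_act (s * t)%g z = mp_act s (mp_act t z).
Proof. by move=> z0; rewrite /mp_act /= mobiusM ?mp_det. Qed.

Lemma mp_act1 (z : R[i]) : mp_act (1%g : mp R) z = z.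
Proof. exact: mobius1. Qed.

Lemma mp_act_uhp s (z : R[i]) : uhp z -> uhp (mp_act s z).
Proof. by apply: mobius_uhp; exact: mp_det. Qed.

Lemma hactM s t p : hact (s * t)%g p = hact s (hact t p).
Proof.
have [p0|p0] := pselect (half_plane p); last by rewrite !hactN.
rewrite hactE// [RHS]hactE; last exact: hact_half_plane.
by rewrite toC_hact// mp_actM.
Qed.

Lemma hact1 p : hact 1%g p = p.
Proof.
have [p0|p0] := pselect (half_plane p); last by rewrite !hactN.
by rewrite hactE// mp_act1 toCK.
Qed.

Lemma hactK s : cancel (hact s) (hact s^-1%g).
Proof. by move=> p; rewrite -hactM mulVg hact1. Qed.

Lemma hactVK s : cancel (hact s^-1%g) (hact s).
Proof. by move=> p; rewrite -hactM mulgV hact1. Qed.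

Local Open Scope ereal_scope.

(** The weight vanishes off the half-plane, so integrals see only the values taken there; that [g]
    is the identity elsewhere gives measurability on the whole plane. *)
Lemma hmeas_preserving_on (G g : R * R -> R * R) : hmeas_preserving G ->
  (forall p, half_plane p -> g p = G p) -> (forall p, ~ half_plane p -> g p = p) ->
  hmeas_preserving g.
Proof.
move=> [mG iG] gG gid.
have mg : measurable_fun setT g.
  rewrite (_ : g = fun p => if (0 < p.2)%R then G p else p).
    apply: measurable_fun_ifT => //.
    by apply: measurable_fun_ltr => //; exact: measurable_snd.
  apply/funext => p; case: ifPn => [/gG//|/negP p0]; exact: gid.
split=> // th mth th0; rewrite -[RHS]iG//.
rewrite !ge0_integral_density//; last 2 first.
- exact: (measurableT_comp mth mG).
- exact: (measurableT_comp mth mg).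
apply: eq_integral => p _; rewrite /hweight; case: ifPn; last by rewrite !mule0.
by move=> /gG ->.
Qed.

Local Close Scope ereal_scope.

Lemma mobiusP (g : 'M[R]_2) z w : \det g = 1%R -> uhp z ->
  ((g 0 0)%:C * z + (g 0 1)%:C = w * autom g z -> mobius g z = w)%R.
Proof.
move=> g1 z0 e; apply: (mulIf (autom_neq0 g1 z0)).
by rewrite -e /mobius divfK// autom_neq0.
Qed.

(** For c = 0 the map is z |-> a^2 z + a b; otherwise it is z |-> a/c - 1/(c^2 z + c d), a composite
    of dilation, translation, inversion and translation. *)
Lemma hact_preserving s : hmeas_preserving (hact s).
Proof.
have := mp_det s; rewrite det2; set g := mp_mx s.
set a := g 0 0; set b := g 0 1; set c := g 1 0; set d := g 1 1 => g1.
have [c0|c0] := eqVneq c 0%R.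
  have ad : (a * d = 1)%R by rewrite -g1 c0 mulr0 subr0.
  have a0 : (a != 0)%R by apply: contra_eq_neq ad => ->; rewrite mul0r eq_sym oner_eq0.
  have a2 : (0 < a ^+ 2)%R by rewrite exprn_even_gt0.
  apply: (hmeas_preserving_on (hmeas_preserving_comp
    (hmeas_preserving_translation (a * b)%R) (hmeas_preserving_scaling a2))) => p p0; last exact: hactN.
  rewrite hactE// /= -[RHS]toCK; congr ofC; apply: mobiusP => //; first exact: mp_det.
  rewrite /autom -/g -/a -/b -/c -/d.
  have -> : d = (a^-1)%R by rewrite -[RHS]mulr1 -ad mulKf.
  rewrite c0 /toC /=; case: p p0 => x y _ /=.
  by apply/eqP; rewrite eq_complex /=; apply/andP; split; apply/eqP; field.
have c2 : (0 < c ^+ 2)%R by rewrite exprn_even_gt0.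
apply: (hmeas_preserving_on (hmeas_preserving_comp
  (hmeas_preserving_translation (a / c)%R) (hmeas_preserving_comp (hmeas_preserving_inversion R)
   (hmeas_preserving_comp
  (hmeas_preserving_translation (c * d)%R) (hmeas_preserving_scaling c2))))) => p p0; last exact: hactN.
rewrite hactE// /= -[RHS]toCK; congr ofC; apply: mobiusP => //; first exact: mp_det.
rewrite /autom -/g -/a -/b -/c -/d.
have -> : b = ((a * d - 1) / c)%R by rewrite -g1; field.
rewrite /toC /=; case: p p0 => x y; rewrite /half_plane /= => y0.
have y1 : (y != 0)%R by rewrite gt_eqF.
have n0 : ((c ^+ 2 * x + c * d) ^+ 2 + (c ^+ 2 * y) ^+ 2 != 0)%R.
  by rewrite gt_eqF// ltr_wpDl ?sqr_ge0// exprn_even_gt0//= mulf_neq0// sqrf_eq0.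
have n1 : ((c * x + d) ^+ 2 + (c * y) ^+ 2 != 0)%R.
  by rewrite gt_eqF// ltr_wpDl ?sqr_ge0// exprn_even_gt0//= mulf_neq0.
by apply/eqP; rewrite eq_complex /=; apply/andP; split; apply/eqP; field; rewrite ?n0 ?c0.
Qed.

End action_on_pairs.

(** * Holomorphic functions are Borel *)

Section modulus.
Variable R : realType.
Implicit Types z w : R[i].

Lemma cabsE z : (cabs z)%:C = `|z|.
Proof. by rewrite /cabs normc_def. Qed.

Lemma cabs_def z : cabs z = Num.sqrt (complex.Re z ^+ 2 + complex.Im z ^+ 2).
Proof. by rewrite /cabs normc_def; case: z. Qed.

Lemma cabs_ge0 z : 0 <= cabs z.
Proof. by rewrite cabs_def sqrtr_ge0. Qed.

Lemma cabsM z w : cabs (z * w) = cabs z * cabs w.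
Proof. by apply: (@complexI R); rewrite rmorphM /= !cabsE normrM. Qed.

Lemma cabsV z : cabs z^-1 = (cabs z)^-1.
Proof. by apply: (@complexI R); rewrite fmorphV /= !cabsE normfV. Qed.

Lemma cabsX z n : cabs (z ^+ n) = cabs z ^+ n.
Proof. by apply: (@complexI R); rewrite rmorphXn /= !cabsE normrX. Qed.

Lemma cabsN z : cabs (- z) = cabs z.
Proof. by apply: (@complexI R); rewrite !cabsE normrN. Qed.

Lemma cabs0 : cabs (0 : R[i]) = 0.
Proof. by apply: (@complexI R); rewrite !cabsE normr0. Qed.

Lemma cabs_eq0 z : (cabs z == 0) = (z == 0).
Proof. by rewrite -(inj_eq (@complexI R)) cabsE normr_eq0. Qed.

Lemma cabs_real (x : R) : 0 <= x -> cabs x%:C = x.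
Proof. by move=> x0; apply: (@complexI R); rewrite cabsE ger0_norm// lecR. Qed.

Lemma cabsD z w : cabs (z + w) <= cabs z + cabs w.
Proof. by rewrite -lecR rmorphD /= !cabsE ler_normD. Qed.

Lemma cabs_sum (I : Type) (r : seq I) (P : pred I) (F : I -> R[i]) :
  cabs (\sum_(i <- r | P i) F i) <= \sum_(i <- r | P i) cabs (F i).
Proof.
elim/big_ind2: _ => [|x a y b xa yb|//]; first by rewrite cabs0.
by apply: (le_trans (cabsD _ _)); exact: lerD.
Qed.

Lemma ler_Re_cabs z : `|complex.Re z| <= cabs z.
Proof. by rewrite cabs_def -sqrtr_sqr ler_wsqrtr// lerDl sqr_ge0. Qed.

Lemma ler_Im_cabs z : `|complex.Im z| <= cabs z.
Proof. by rewrite cabs_def -sqrtr_sqr ler_wsqrtr// lerDr sqr_ge0. Qed.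

Lemma cabs_le_ReIm z : cabs z <= `|complex.Re z| + `|complex.Im z|.
Proof.
rewrite cabs_def -[leRHS]ger0_norm ?addr_ge0// -sqrtr_sqr ler_wsqrtr//.
rewrite -!(real_normK (num_real (complex.Re z))) -(real_normK (num_real (complex.Im z))).
by rewrite sqrrD lerD2r lerDl mulrn_wge0// mulr_ge0.
Qed.

Lemma cabs_conj z : cabs z^* = cabs z.
Proof. by apply: (@complexI R); rewrite !cabsE norm_conjC. Qed.

Lemma nbhs_cabs (z : R[i]) (P : set R[i]) :
  nbhs z P -> exists2 e : R, 0 < e & forall w, cabs (w - z) < e -> P w.
Proof.
move=> /nbhs_normP[[e e'] /= e0 h].
(* The radius of a ball is an element of [R[i]]; being positive, it is real. *)
have [e1 e2] : 0 < e /\ e' = 0.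
  by move: e0; rewrite ltcE/= => /andP[/eqP -> ->].
subst e'; exists e => // w wz; apply: h => /=.
by rewrite distrC -cabsE ltcR.
Qed.

Lemma cabs_nbhs (z : R[i]) (P : set R[i]) (e : R) :
  0 < e -> (forall w, cabs (w - z) < e -> P w) -> nbhs z P.
Proof.
move=> e0 h; apply/nbhs_normP; exists e%:C => /=; first by rewrite ltcR.
by move=> w /=; rewrite distrC -cabsE ltcR; exact: h.
Qed.

Lemma cvg_cabsP (T : Type) (F : set_system T) (FF : Filter F) (h : T -> R[i]) (l : R[i]) :
  h @ F --> l <-> (forall e : R, 0 < e -> \forall x \near F, cabs (h x - l) < e).
Proof.
split=> [hl e e0|he].
  by apply: (hl [set w | cabs (w - l) < e]); exact: (cabs_nbhs e0).
by move=> P /nbhs_cabs[e e0 eP]; apply: filterS (he e e0) => x; exact: eP.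
Qed.

Lemma derivable_cabs (h : R[i] -> R[i]) z : derivable h z 1 ->
  forall e : R, 0 < e -> exists2 d : R, 0 < d &
    forall w, cabs (w - z) < d -> cabs (h w - h z) < e.
Proof.
move=> /derivable1_diffP/differentiable_continuous hz e e0.
apply: nbhs_cabs; apply: (hz [set w | cabs (w - h z) < e]); exact: (cabs_nbhs e0).
Qed.

End modulus.

Section borel.
Variable R : realType.
Implicit Types p q : R * R.

Lemma cabs_toC p q (e : R) : `|p.1 - q.1| < e / 2 -> `|p.2 - q.2| < e / 2 ->
  cabs (toC p - toC q) < e.
Proof.
move=> h1 h2; apply: (le_lt_trans (cabs_le_ReIm _)) => /=.
by rewrite [e]splitr; exact: ltrD.
Qed.

Let box (a : (rat * rat) * (rat * rat)) : set (R * R) :=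
  [set p | ratr a.1.1 < p.1 < ratr a.1.2 /\ ratr a.2.1 < p.2 < ratr a.2.2].

Let measurable_box a : measurable (box a).
Proof.
rewrite (_ : box a = `]ratr a.1.1, ratr a.1.2[%classic `*` `]ratr a.2.1, ratr a.2.2[%classic).
  exact: measurableX.
by apply/seteqP; split=> -[x y]; rewrite /box/= !in_itv.
Qed.

(** An open set is the union of the rational boxes that it contains, and these are countably
    many. *)
Lemma open_measurable_pair (A : set (R * R)) :
  (forall p, A p -> exists2 e : R, 0 < e & forall q, cabs (toC q - toC p) < e -> A q) ->
  measurable A.
Proof.
move=> oA; pose D := [set a | box a `<=` A].
rewrite (_ : A = \bigcup_a (if `[< D a >] then box a else set0)).
  apply: countable_bigcupT_measurable => [|a]; first exact: countableP.
  by case: ifPn.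
apply/seteqP; split=> [p Ap|p [a _]]; last by case: ifPn => // /asboolP; exact.
have [e e0 pe] := oA p Ap; have e2 : 0 < e / 2 by rewrite divr_gt0.
have rat_near (x : R) : exists2 b : rat * rat, ratr b.1 < x < ratr b.2 &
    forall y, ratr b.1 < y < ratr b.2 -> `|y - x| < e / 2.
  have [|b1 /[!in_itv]/= /andP[b11 b12]] := @rat_in_itvoo R (x - e / 2) x.
    by rewrite ltrBlDr ltrDl.
  have [|b2 /[!in_itv]/= /andP[b21 b22]] := @rat_in_itvoo R x (x + e / 2).
    by rewrite ltrDl.
  exists (b1, b2); rewrite /= ?b12// => y /andP[y1 y2]; rewrite ltr_distl.
  by rewrite (lt_trans b11 y1) (lt_trans y2 b22).
have [a1 pa1 a1e] := rat_near p.1; have [a2 pa2 a2e] := rat_near p.2.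
exists (a1, a2) => //; rewrite asboolT// => q [q1 q2].
by apply: pe; apply: cabs_toC; [exact: a1e|exact: a2e].
Qed.

(** Complex differentiability gives continuity, so the points of the half-plane where the real or
    imaginary part exceeds a given bound form an open set. *)
Lemma derivable_borel (h : R[i] -> R[i]) :
  (forall z, uhp z -> derivable h z 1) -> borel_funC uhp h.
Proof.
move=> dh.
have aux (pr : R[i] -> R) : (forall z w, `|pr z - pr w| <= cabs (z - w)) ->
    measurable_fun (@toC R @^-1` uhp) (fun p => pr (h (toC p))).
  move=> prle mH; apply: (measurability _ (RGenOInfty.measurableE R)) => //.
  move=> _ [_ [a ->] <-]; apply: open_measurable_pair => p [p0 /=].
  rewrite in_itv/= andbT => ap.
  have [e e0 he] := nbhs_cabs (uhp_near p0).
  have [d d0 hd] := derivable_cabs (dh _ p0) (e := pr (h (toC p)) - a) ltac:(by rewrite subr_gt0).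
  exists (Num.min e d) => [|q]; first by rewrite lt_min e0.
  rewrite lt_min => /andP[/he q0 /hd hq]; split => //=; rewrite in_itv/= andbT.
  have := le_lt_trans (prle _ _) hq; rewrite ltr_distl => /andP[+ _].
  by rewrite opprB addrC subrK.
split; apply: aux => -[a b] [c d] /=.
  by have := ler_Re_cabs ((a +i* b) - (c +i* d)).
by have := ler_Im_cabs ((a +i* b) - (c +i* d)).
Qed.

End borel.

(** * Elements acting trivially and fixed points *)

Section null_sets.
Variable R : realType.
Notation mu := (@lebesgue_measure R).

Lemma negligible_hmeas (A : set (R * R)) :
  (mu \x mu)%E.-negligible A -> (@hmeas R).-negligible A.
Proof.
move=> [B [mB B0 AB]]; exists B; split => //.
have mw : measurable_fun B (EFin \o @hweight R).
  by apply/measurable_EFinP; apply: measurable_funTS; exact: measurable_hweight.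
rewrite /= /hmeas /density -[RHS](@integral_abs_eq0 _ _ _ (mu \x mu)%E _ _ mB mw B0).
by apply: eq_integral => p _ /=; rewrite ger0_norm ?hweight_ge0.
Qed.

Lemma negligible_vertical (a : R) : (@hmeas R).-negligible [set p | p.1 = a].
Proof.
apply: negligible_hmeas; rewrite (_ : [set p | _] = [set a] `*` setT); last first.
  by apply/seteqP; split=> -[x y] //= [].
apply/negligibleP; first exact: measurableX.
by rewrite /= product_measure1E// [X in (X * _)%E](lebesgue_measure_set1 a) mul0e.
Qed.

Lemma hmeas_preimage (g : R * R -> R * R) A : hmeas_preserving g -> measurable A ->
  hmeas (g @^-1` A) = hmeas A.
Proof.
move=> [mg ig] mA.
have mgA : measurable (g @^-1` A) by rewrite -[_ @^-1` _]setTI; exact: mg.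
have m1A : measurable_fun setT (EFin \o \1_A : R * R -> \bar R).
  by apply/measurable_EFinP; exact: measurable_indic.
have E B : measurable B -> hmeas B = (\int[@hmeas R]_p (\1_B p)%:E)%E.
  by move=> mB; rewrite integral_indic// setIT.
rewrite !E// -(ig _ m1A)// => p.
by rewrite lee_fin.
Qed.

Lemma negligible_hact (s : mp R) (A : set (R * R)) :
  (@hmeas R).-negligible A -> (@hmeas R).-negligible (hact s @^-1` A).
Proof.
move=> [B [mB B0 AB]]; exists (hact s @^-1` B); split.
- by rewrite -[_ @^-1` _]setTI; apply: (hact_preserving s).1.
- by rewrite /= (hmeas_preimage (hact_preserving s)).
- by move=> p /= /AB.
Qed.

(** The imaginary part of the fixed point equation is y (a - d) = 2 c x y, which determines x when c
    is non-zero. When c = 0 a fixed point would force a = d and b = 0, that is, a trivial action. *)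
Lemma hact_fixed_vertical (s : mp R) : (exists2 z, uhp z & mp_act s z != z) ->
  exists a : R, forall p, half_plane p -> hact s p = p -> p.1 = a.
Proof.
move=> [z zH sz]; have := mp_det s; rewrite det2; set g := mp_mx s.
set a := g 0 0; set b := g 0 1; set c := g 1 0; set d := g 1 1 => g1.
exists ((a - d) / (2 * c)) => -[x y] y0; rewrite /half_plane/= in y0 *.
rewrite hactE// => /(congr1 (@toC R)); rewrite ofCK => sp.
have n0 : autom g (toC (x, y)) != 0 by apply: autom_neq0 => //; exact: mp_det.
have : a%:C * toC (x, y) + b%:C = toC (x, y) * autom g (toC (x, y)).
  by rewrite -[X in _ = X * _]sp /mp_act /mobius divfK.
rewrite /autom -/g -/c -/d /toC /= => /eqP; rewrite eq_complex /= => /andP[/eqP e1 /eqP e2].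
have e3 : a = 2 * c * x + d.
  apply: (mulIf (lt0r_neq0 y0)); rewrite mulrDl.
  by move: e2; lra.
have [c0|c0] := eqVneq c 0; last by rewrite e3; field; rewrite c0.
have ad : a = d by rewrite e3 c0; ring.
have b0 : b = 0 by move: e1; rewrite c0 ad; lra.
exfalso; move/eqP: sz; apply; apply: mobiusP => //; first exact: mp_det.
by rewrite /autom -/g -/a -/b -/c -/d c0 b0 ad; ring.
Qed.

Lemma negligible_fixed (s : mp R) : (exists2 z, uhp z & mp_act s z != z) ->
  (@hmeas R).-negligible [set p | half_plane p /\ hact s p = p].
Proof.
move=> /hact_fixed_vertical[a ap]; apply: negligibleS (negligible_vertical a).
by move=> p [p0 sp]; exact: ap.
Qed.

(** The elements over 1 and -1. Unfolding is naturally modulo these; [mp_trivial_center] makes them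
    central where the hypothesis on [chi] is applied. *)
Definition mp_trivial (s : mp R) := forall z, uhp z -> mp_act s z = z.

Lemma uhp_i : uhp ('i%C : R[i]). Proof. by rewrite /uhp /=. Qed.

(** That i y is fixed means a = d and b = - c y^2; comparing y = 1 with y = 2 gives b = c = 0. *)
Lemma mp_trivialP (s : mp R) : mp_trivial s ->
  exists2 e : R, e ^+ 2 = 1 & mp_mx s = e%:M.
Proof.
move=> sT; have := mp_det s; rewrite det2; set g := mp_mx s.
set a := g 0 0; set b := g 0 1; set c := g 1 0; set d := g 1 1 => g1.
have key (y : R) : 0 < y -> a = d /\ b = - c * y ^+ 2.
  move=> y0; have zH : uhp (0 +i* y) by [].
  have n0 : autom g (0 +i* y) != 0 by apply: autom_neq0 => //; exact: mp_det.
  have : a%:C * (0 +i* y) + b%:C = (0 +i* y) * autom g (0 +i* y).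
    by rewrite -[X in _ = X * _](sT _ zH) /mp_act /mobius divfK.
  rewrite /autom -/g -/c -/d /= => /eqP; rewrite eq_complex /= => /andP[/eqP e1 /eqP e2].
  split; last by move: e1; lra.
  by apply: (mulIf (lt0r_neq0 y0)); move: e2; lra.
have [ad b1] := key 1 ltr01; have [_ b2] := key 2 (ltr0n _ 2).
have c0 : c = 0 by move: b2; rewrite b1; lra.
have b0 : b = 0 by rewrite b1 c0; ring.
exists a; first by move: g1; rewrite b0 mul0r subr0 -ad expr2.
apply/matrixP => i j; rewrite !mxE.
have ord2 (P : 'I_2 -> Prop) : P 0 -> P 1 -> forall i, P i.
  move=> P0 P1 [[|[|//]] k]; [rewrite (_ : Ordinal k = 0)//|rewrite (_ : Ordinal k = 1)//]; exact/val_inj.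
elim/ord2: i; elim/ord2: j => //=; rewrite ?mulr1n ?mulr0n//.
Qed.

(** The square of eta is the constant e, so eta can change only by a sign; along the segment from z
    to w the intermediate value theorem excludes a change. *)
Lemma mp_eta_trivial (s : mp R) : mp_trivial s ->
  forall z w, uhp z -> uhp w -> mp_eta s z = mp_eta s w.
Proof.
move=> sT z w z0 w0; have [e e1 se] := mp_trivialP sT.
have aE y : autom (mp_mx s) y = e%:C by rewrite se /autom !mxE /= mulr0n mulr1n mul0r add0r.
have en0 : e != 0 by apply: contra_eq_neq e1 => ->; rewrite expr0n/= eq_sym oner_eq0.
pose c (t : R) := z + t%:C * (w - z).
have cH t : 0 <= t <= 1 -> uhp (c t).
  move=> /andP[t0 t1]; rewrite /c /uhp; case: (z) (w) z0 w0 => a b [a' b'].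
  rewrite /uhp /= => b0 b'0; nra.
have nz := mp_eta_neq0 s z0.
pose r t := complex.Re (mp_eta s (c t) / mp_eta s z).
have r2 t : 0 <= t <= 1 ->
    mp_eta s (c t) / mp_eta s z = 1 \/ mp_eta s (c t) / mp_eta s z = -1.
  move=> /cH tH; have : (mp_eta s (c t) / mp_eta s z) ^+ 2 = 1.
    by rewrite exprMn exprVn !mp_eta2// !aE divff// fmorph_eq0.
  by move=> /eqP; rewrite sqrf_eq1 => /orP[]/eqP ->; [left|right].
have c0 : c 0 = z by rewrite /c mul0r addr0.
have c1 : c 1 = w by rewrite /c mul1r addrC subrK.
have rc : {within `[0, 1], continuous r}.
  apply: continuous_in_subspaceT => t; rewrite inE/= in_itv/= => /cH tH.
  apply/cvgrPdist_lt => e' e'0.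
  have zc : 0 < cabs (mp_eta s z) by rewrite lt_neqAle eq_sym cabs_eq0 nz cabs_ge0.
  have [d d0 hd] := derivable_cabs (@mp_holo _ s _ tH) (mulr_gt0 e'0 zc).
  have w1 : 0 < cabs (w - z) + 1 by rewrite ltr_wpDl// cabs_ge0.
  have dw : 0 < d / (cabs (w - z) + 1) by rewrite divr_gt0.
  near=> t'.
  have tt' : `|t' - t| < d / (cabs (w - z) + 1).
    by rewrite distrC; near: t'; exact: (@cvgr_dist_lt _ _ _ _ _ id t).
  have /hd : cabs (c t' - c t) < d.
    have -> : c t' - c t = (t' - t)%:C * (w - z) by rewrite /c rmorphB/=; ring.
    rewrite cabsM; have -> : cabs (t' - t)%:C = `|t' - t|.
      by rewrite cabs_def/= expr0n addr0 sqrtr_sqr.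
    apply: (@le_lt_trans _ _ (`|t' - t| * (cabs (w - z) + 1))).
      by rewrite ler_wpM2l// lerDl.
    by rewrite -ltr_pdivlMr.
  rewrite -ltr_pdivrMr// -cabsV -cabsM mulrBl distrC; apply: le_lt_trans.
  apply: le_trans (ler_Re_cabs _); rewrite /r.
  by case: (_ / _) => ? ?; case: (_ / _).
have /r2[] : 0 <= (1 : R) <= 1 by rewrite ler01 lexx.
  rewrite c1 => /(congr1 (fun x => x * mp_eta s z)).
  by rewrite divfK// mul1r => ->.
move=> r1; have [|t] := @IVT R r 0 1 0 ler01 rc.
  by rewrite /r r1 c0 divff//= ge_min le_max/= lerN10 ler01 orbT.
by rewrite in_itv/= => /r2[]; rewrite /r => ->/= /eqP; rewrite ?oppr_eq0 oner_eq0.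
Unshelve. all: by end_near. Qed.

End null_sets.

Section trivial_elements.
Variable R : realType.
Implicit Types (s t : mp R).

Lemma expiD (a b : R) : expi (a + b) = expi a * expi b.
Proof.
by rewrite /expi cosD sinD; apply/eqP; rewrite eq_complex/= eqxx/= addrC [X in _ + X]mulrC eqxx.
Qed.

Lemma expi0 : expi (0 : R) = 1.
Proof. by rewrite /expi cos0 sin0. Qed.

Lemma expiX (a : R) n : expi a ^+ n = expi (n%:R * a).
Proof.
elim: n => [|n IH]; first by rewrite expr0 mul0r expi0.
by rewrite exprS IH -expiD -natr1 mulrDl mul1r addrC.
Qed.

Lemma expi_conj (a : R) : (expi a)^* = expi (- a).
Proof. by rewrite /expi cosN sinN. Qed.

Lemma cabs_expi (a : R) : cabs (expi a) = 1.
Proof. by rewrite cabs_def/= cos2Dsin2 sqrtr1. Qed.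

Lemma mp_trivial_center s : mp_trivial s -> mp_center s.
Proof.
move=> sT t; have [e _ se] := mp_trivialP sT.
apply: mp_eq => [|z z0] /=; first by rewrite se scalar_mxC.
rewrite !off0E// -!/(mp_act _ _) sT// mulrC; congr (_ * _).
by apply: mp_eta_trivial => //; exact: mp_act_uhp.
Qed.

(** Since eta(i)^2 = e, there are four cases: eta(i) = 1, -1 over the identity, with t = 0, 2 pi,
    and eta(i) = i, -i over its opposite, with t = pi, - pi. *)
Lemma mp_trivial_kappa s : mp_trivial s -> exists t : R, is_kappa t s.
Proof.
move=> sT; have [e e1 se] := mp_trivialP sT.
have h2 := mp_eta2 s (uhp_i R).
have {}h2 : mp_eta s 'i%C ^+ 2 = e%:C.
  by rewrite h2 se /autom !mxE /= mulr0n mulr1n mul0r add0r.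
have mxE' (t : R) : sin t = 0 -> cos t = e -> mp_mx s = \matrix_(i, j) (if i == j then cos t
                            else if i == 0 then - sin t else sin t).
  move=> st ct; rewrite se; apply/matrixP => i j; rewrite !mxE st ct oppr0 if_same.
  by case: eqP => _; rewrite ?mulr1n ?mulr0n.
have : (e == 1) || (e == -1) by rewrite -sqrf_eq1 e1.
move=> /orP[]/eqP ee.
  move: h2; rewrite ee => /eqP; rewrite sqrf_eq1 => /orP[]/eqP h.
    by exists 0; split; rewrite ?mul0r ?expi0//; apply: mxE'; rewrite ?sin0 ?cos0 ?ee.
  exists (2 * pi); split; first by apply: mxE'; rewrite mulr_natl ?sin2pi ?cos2pi ?ee.
  by rewrite mulrC mulKf// /expi cospi sinpi h; apply/eqP; rewrite eq_complex/= oppr0 !eqxx.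
have ii : 'i%C ^+ 2 = -1 :> R[i].
  by apply/eqP; rewrite expr2 eq_complex/= !mul0r !mulr0 mulr1 sub0r addr0 oppr0 !eqxx.
move: h2; rewrite ee (_ : (-1)%:C = 'i%C ^+ 2); last by rewrite ii rmorphN.
move=> /eqP; rewrite eqf_sqr => /orP[]/eqP h.
  exists pi; split; first by apply: mxE'; rewrite ?sinpi ?cospi ?ee.
  by rewrite h /expi cos_pihalf sin_pihalf.
exists (- pi); split; first by apply: mxE'; rewrite ?sinN ?cosN ?sinpi ?cospi ?ee ?oppr0.
by rewrite h /expi mulNr cosN sinN cos_pihalf sin_pihalf; apply/eqP; rewrite eq_complex/= oppr0 !eqxx.
Qed.

End trivial_elements.

(** * Terms of the Poincare series *)

Section terms.
Variable R : realType.
Variables (G L : set (mp R)) (chi : mp R -> R[i]) (k : nat) (f : R[i] -> R[i]).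
Implicit Types (s t : mp R).

Definition term s z : R[i] := (chi s)^* * slash k f s z.

Hypotheses (Gsub : mp_subgroup G) (LG : L `<=` G) (chiU : unitary_character G chi).

Lemma slashM (h : R[i] -> R[i]) s t z : uhp z ->
  slash k h (s * t)%g z = slash k h s (mp_act t z) * mp_eta t z ^- (2 * k + 1).
Proof.
by move=> z0; rewrite /slash mp_actM//= off0E// exprMn invfM !mulrA.
Qed.

Lemma chi_conjK s : G s -> (chi s)^* * chi s = 1.
Proof. by move=> /chiU.2 s1; rewrite mulrC -normCK s1 expr1n. Qed.

(** The factor in front does not depend on [s]: summed over the cosets, this is the transformation
    law of the Poincare series. *)
Lemma term_mulr s t z : G s -> G t -> uhp z ->
  term s (mp_act t z) = chi t * mp_eta t z ^+ (2 * k + 1) * term (s * t)%g z.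
Proof.
move=> Gs Gt z0; rewrite /term slashM// chiU.1// rmorphM/=.
have n0 := mp_eta_neq0 t z0.
have e0 : mp_eta t z ^+ (2 * k + 1) != 0 by rewrite expf_neq0.
rewrite -[LHS]mul1r -(chi_conjK Gt).
by field; rewrite expf_neq0.
Qed.

Lemma term_mull l s z : (forall l z, L l -> uhp z -> slash k f l z = chi l * f z) ->
  L l -> G s -> uhp z -> term (l * s)%g z = term s z.
Proof.
move=> f1 Ll Gs z0; have Gl := LG Ll.
rewrite /term slashM// f1//; last exact: mp_act_uhp.
rewrite chiU.1// rmorphM/= /slash -[RHS]mul1r -(chi_conjK Gl); ring.
Qed.

(** If l = kappa_t, the conjugate of chi(l) is e^(i m t) and eta_l^(-2m) is e^(-i m t), so they
    cancel. *)
Lemma term_trivial l s z : central_character G chi (weight R k) ->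
  mp_trivial l -> G l -> G s -> uhp z -> term (l * s)%g z = term s z.
Proof.
move=> cc lT Gl Gs z0; have sz0 := mp_act_uhp s z0.
rewrite /term slashM// chiU.1// rmorphM/= {1}/slash lT// .
have [t [lt etai]] := mp_trivial_kappa lT.
have eta : mp_eta l (mp_act s z) ^+ (2 * k + 1) = expi (weight R k * t).
  rewrite (mp_eta_trivial lT sz0 (uhp_i R)) etai expiX; congr expi.
  by rewrite /weight natrD natrM; field.
rewrite eta (cc l t)//; last exact: mp_trivial_center.
rewrite expi_conj opprK.
have e0 : expi (weight R k * t) != 0 by rewrite -cabs_eq0 cabs_expi oner_eq0.
by rewrite /slash; field; rewrite expf_neq0 ?mp_eta_neq0.
Qed.

Lemma Im_mp_act s z : uhp z ->
  complex.Im (mp_act s z) = complex.Im z / cabs (mp_eta s z) ^+ 4.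
Proof.
move=> z0; have -> : cabs (mp_eta s z) ^+ 4 = cabs (autom (mp_mx s) z) ^+ 2.
  by rewrite -mp_eta2// cabsX -exprM.
have n0 := autom_neq0 (mp_det s) z0.
have := mp_det s; rewrite det2 /mp_act /mobius; move: n0; rewrite /autom.
move: (mp_mx s 0 0) (mp_mx s 0 1) (mp_mx s 1 0) (mp_mx s 1 1) => a b c d n0 g1.
rewrite cabs_def sqr_sqrtr ?addr_ge0 ?sqr_ge0//; case: z z0 n0 => x y y0 n0.
have D0 : (c * x + d) ^+ 2 + (c * y) ^+ 2 != 0.
  apply: contra n0; rewrite paddr_eq0 ?sqr_ge0 // !sqrf_eq0.
  move=> /andP[/eqP h1 /eqP h2]; rewrite eq_complex /= !mul0r subr0 !addr0.
  by rewrite h1 h2 !eqxx.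
rewrite /= !(mul0r, subr0, addr0, mulr0); rewrite -[X in _ = X / _]mul1r -g1.
by field.
Qed.

(** The exponent m/2 is the right one because |eta|^4 = |c z + d|^2: the m/2-th power of Im(z) /
    |eta|^4 produces the factor |eta|^(-2m) of the slash action. *)
Lemma cabs_normalized_act (h : R[i] -> R[i]) s z : uhp z ->
  cabs (normalized k h (mp_act s z)) =
  cabs (slash k h s z) * complex.Im z `^ (weight R k / 2).
Proof.
move=> z0; rewrite /normalized /slash !cabsM Im_mp_act//.
have n0 : 0 < cabs (mp_eta s z) by rewrite lt_neqAle eq_sym cabs_eq0 mp_eta_neq0// cabs_ge0.
rewrite -mulrA; congr (_ * _); rewrite cabs_real ?powR_ge0// powRM ?(ltW z0)//; last first.
  by rewrite invr_ge0 exprn_ge0// ltW.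
rewrite mulrC; congr (_ * _); rewrite cabsV cabsX.
move: n0; move: (cabs _) => q q0.
rewrite -!powR_mulrn ?(ltW q0)// -!powRN -powRrM; congr (_ `^ _).
by rewrite /weight natrD natrM; field.
Qed.

Lemma cabs_term s z : G s -> cabs (term s z) = cabs (slash k f s z).
Proof.
move=> Gs; rewrite /term cabsM cabs_conj.
have -> : cabs (chi s) = 1 by apply: (@complexI R); rewrite cabsE chiU.2.
by rewrite mul1r.
Qed.

End terms.

(** * Discrete subgroups are countable *)

Section countability.
Variable R : realType.

(* Points of A that are e-separated from A are coded by a rational approximation
   of their coordinates together with the precision used. *)
Lemma countable_separated (T : Type) (n : nat) (c : T -> 'I_n -> R) (A : set T) :
  (forall s, A s -> exists2 e : R, 0 < e &
     forall t, A t -> (forall j, `|c t j - c s j| < e) -> t = s) ->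
  countable A.
Proof.
move=> Asep.
(* Points with the same code are each within the precision of one rational point, hence within twice
   the precision of each other; this is why the code takes a precision below e / 2. *)
have codeP s : exists a : nat * {ffun 'I_n -> rat}, A s ->
    (forall j, `|c s j - ratr (a.2 j)| < a.1.+1%:R^-1) /\
    (forall t, A t -> (forall j, `|c t j - c s j| < a.1.+1%:R^-1 + a.1.+1%:R^-1) -> t = s).
  have [/Asep[e e0 es]|nAs] := pselect (A s); last by exists (0%N, [ffun=> 0]).
  have e2 : 0 < e / 2 by rewrite divr_gt0.
  have [m _ me] := near_infty_natSinv_lt (PosNum e2).
  have m0 : 0 < (m.+1%:R : R)^-1 by rewrite invr_gt0.
  have /choice[q qP] : forall j, exists q : rat, `|c s j - ratr q| < m.+1%:R^-1.
    move=> j; have [|q] := @rat_in_itvoo R (c s j) (c s j + m.+1%:R^-1).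
      by rewrite ltrDl.
    rewrite in_itv/= => /andP[q1 q2]; exists q.
    by rewrite distrC ger0_norm ?subr_ge0 ?(ltW q1)// ltrBlDl.
  exists (m, [ffun j => q j]) => _; split => [j|t At tj]; first by rewrite ffunE.
  apply: es => // j; apply: (lt_trans (tj j)); rewrite [e]splitr.
  by rewrite ltrD//; apply: me => /=.
have [code codeA] := choice codeP.
apply/countable_injP; exists (fun s => choice.pickle (code s)) => s t /set_mem As /set_mem At.
move=> /(pcan_inj choice.pickleK) st.
have [h1 _] := codeA s As; have [h2 h3] := codeA t At.
apply: h3 => // j; rewrite -(subrKA (ratr ((code s).2 j))).
apply: (le_lt_trans (ler_normD _ _)); rewrite -st; apply: ltrD; first exact: h1.
by rewrite distrC st; exact: h2.
Qed.

Definition mp_coords (s : mp R) : 'I_6 -> R := fun j => nth 0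
  [:: mp_mx s 0 0; mp_mx s 0 1; mp_mx s 1 0; mp_mx s 1 1;
      complex.Re (mp_eta s 'i%C); complex.Im (mp_eta s 'i%C)] j.

Lemma mp_discrete_countable (G : set (mp R)) : mp_discrete G -> countable G.
Proof.
move=> dG; apply: (@countable_separated _ 6 mp_coords) => s Gs.
have [_ [V nV VG]] := dG s Gs.
have [_ [[B oB <-] Bs BV]] := nV.
have [[P Q] /= [[P' nP P'P] nQ] PQB] : nbhs (mp_coord s) B by apply: open_nbhs_nbhs.
have [d d0 dQ] := nbhs_cabs nQ.
have hP i j : exists2 e : R, 0 < e & forall y, `|y - mp_mx s i j| < e -> P' i j y.
  have /nbhs_normP[e /= e0 eP] := nP i j; exists e => // y yx; apply: eP => /=.
  by rewrite distrC.
have [e00 p00 h00] := hP 0 0; have [e01 p01 h01] := hP 0 1.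
have [e10 p10 h10] := hP 1 0; have [e11 p11 h11] := hP 1 1.
(* The last two coordinates are the real and imaginary parts of eta(i); d / 2 for each makes the
   modulus of the difference less than d. *)
exists (Num.min (Num.min (Num.min e00 e01) (Num.min e10 e11)) (d / 2)).
  by rewrite !lt_min p00 p01 p10 p11 divr_gt0.
move=> t Gt tj; suff : (V `&` G) t by rewrite VG.
split=> //; apply: BV; apply: PQB; split => /=.
  apply: P'P => i j.
  have ord2 (K : 'I_2 -> Prop) : K 0 -> K 1 -> forall i, K i.
    move=> K0 K1 [[|[|//]] l]; [rewrite (_ : Ordinal l = 0)//|rewrite (_ : Ordinal l = 1)//]; exact/val_inj.
  have t0 := tj 0; have t1 := tj 1; have t2 := tj (inord 2); have t3 := tj (inord 3).
  move: t0 t1 t2 t3; rewrite /mp_coords !inordK//= !lt_min => t0 t1 t2 t3.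
  elim/ord2: i; elim/ord2: j; [apply: h00|apply: h01|apply: h10|apply: h11].
  - by move: t0 => /andP[/andP[/andP[]]].
  - by move: t1 => /andP[/andP[/andP[]]].
  - by move: t2 => /andP[/andP[_ /andP[]]].
  - by move: t3 => /andP[/andP[_ /andP[]]].
apply: dQ; apply: (le_lt_trans (cabs_le_ReIm _)).
have := tj (inord 4); have := tj (inord 5).
rewrite /mp_coords !inordK//= !lt_min => /andP[_ t5] /andP[_ t4].
rewrite [d]splitr; case: (mp_eta t _) (mp_eta s _) t4 t5 => ? ? [? ?] /= t4 t5.
exact: ltrD.
Qed.

End countability.

(** * Unordered sums *)

Section unordered_sums.
Variable R : realType.

Lemma cvg_series_cabs (u : nat -> R[i]) : cvgn (series (fun n => cabs (u n))) ->
  exists U : R[i], series u @ \oo --> U.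
Proof.
move=> cu.
have part (pr : {additive R[i] -> R}) : (forall z, `|pr z| <= cabs z) ->
    exists l : R, (fun n => pr (series u n)) @ \oo --> l.
  move=> prle; have : cvgn (series (fun n => pr (u n))).
    apply: normed_cvg; apply: (series_le_cvg _ _ _ cu) => n //=.
    exact: cabs_ge0.
  move=> h; exists (limn (series (fun n => pr (u n)))).
  by under eq_fun do rewrite /series/= raddf_sum.
have [a ua] := part (@complex.Re R : {additive _ -> _}) (@ler_Re_cabs R).
have [b ub] := part (@complex.Im R : {additive _ -> _}) (@ler_Im_cabs R).
exists (a +i* b); apply/cvg_cabsP => e e0.
have e2 : 0 < e / 2 by rewrite divr_gt0.
move/cvgrPdist_lt : ua => /(_ _ e2) ua; move/cvgrPdist_lt : ub => /(_ _ e2) ub.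
near=> n.
have h1 : `|a - complex.Re (series u n)| < e / 2 by near: n.
have h2 : `|b - complex.Im (series u n)| < e / 2 by near: n.
apply: le_lt_trans (cabs_le_ReIm _) _; rewrite [e]splitr.
move: h1 h2; case: (series u n) => x y /= h1 h2.
by rewrite ltrD// distrC.
Unshelve. all: by end_near. Qed.

(* The terms of the unordered family t are those of the sequence u, each
   repeated size zs times: the index set is zs x J through c. *)
Lemma cvg_partial_sum_blocks (C : choiceType) (Z : eqType) (zs : seq Z) (J : pred nat)
    (c : Z -> nat -> C) (t : C -> R[i]) (u : nat -> R[i]) (U : R[i]) :
  uniq zs ->
  (forall z z' n n', z \in zs -> z' \in zs -> J n -> J n' -> c z n = c z' n' ->
     z = z' /\ n = n') ->
  (forall x, exists z n, [/\ z \in zs, J n & x = c z n]) ->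
  (forall z n, z \in zs -> J n -> t (c z n) = u n) ->
  (forall n, ~~ J n -> u n = 0) ->
  cvgn (series (fun n => cabs (u n))) -> series u @ \oo --> U ->
  partial_sum t @ totally --> (size zs)%:R * U.
Proof.
move=> uzs cinj csurj tu u0 cu uU.
pose K (N : nat) := [seq c z n | z <- zs, n <- [seq n <- iota 0 N | J n]].
have uK N : uniq (K N).
  apply: allpairs_uniq => //; first by rewrite filter_uniq// iota_uniq.
  move=> [z n] [z' n'] /allpairsP[[a b] /= [az]].
  rewrite mem_filter => /andP[bJ _] [-> ->] /allpairsP[[a' b'] /= [az']].
  rewrite mem_filter => /andP[bJ' _] [-> ->].
  by move=> /(cinj _ _ _ _ az az' bJ bJ')[-> ->].
have memK N x : (x \in K N) <-> exists z n, [/\ z \in zs, J n, (n < N)%N & x = c z n].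
  split=> [/allpairsP[[z n]/= [zz]]|[z [n [zz Jn nN ->]]]].
    by rewrite mem_filter mem_iota/= add0n => /andP[Jn nN] ->; exists z, n.
  by apply: allpairs_f => //; rewrite mem_filter Jn mem_iota.
have sumK (V : zmodType) (phi : C -> V) (v : nat -> V) N :
    (forall z n, z \in zs -> J n -> phi (c z n) = v n) ->
    (forall n, ~~ J n -> v n = 0) ->
    \sum_(x <- K N) phi x = (series v N) *+ size zs.
  move=> phiv v0; rewrite /K big_allpairs_dep.
  transitivity (\sum_(z <- zs) series v N); last by rewrite big_const_seq count_predT iter_addr addr0.
  apply: eq_big_seq => z zz; rewrite big_filter /series/= /index_iota subn0.
  rewrite [RHS](bigID J)/= [X in _ + X]big1 ?addr0//.
  by apply: eq_bigr => n Jn; exact: phiv.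
pose a n := cabs (u n); pose V := limn (series a).
have nda : {homo series a : m n / (m <= n)%N >-> m <= n}.
  by apply/nondecreasing_seqP => n; rewrite /series/= big_nat_recr//= lerDl cabs_ge0.
have aV N : series a N <= V by exact: nondecreasing_cvgn_le.
have d0 : 0 < (size zs).+1%:R :> R by rewrite ltr0n.
have FF : ProperFilter (@totally C) by exact: totally_filter.
apply/cvg_cabsP => e e0.
have dle (x : R) : 0 <= x -> (size zs)%:R * x <= (size zs).+1%:R * x.
  by move=> x0; rewrite ler_wpM2r// ler_nat.
(* The successor avoids division by zero for empty [zs]. One half of [e] is for the sum over [K N],
   the other for the tail of the absolute values. *)
have e2 : 0 < e / 2 / (size zs).+1%:R by rewrite !divr_gt0.
have [N _ hN] : \forall n \near \oo, cabs (series u n - U) < e / 2 / (size zs).+1%:R /\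
    `|V - series a n| < e / 2 / (size zs).+1%:R.
  near=> n; split; near: n; first by move/cvg_cabsP: uU; exact.
  by move/cvgrPdist_lt: cu; exact.
have [h1 h2] := hN N (leqnn N).
exists [fset x in K N]%fset => // A /= /fsubsetP KA.
(* A finite set [A] containing [K N] lies in some [K M], so its terms outside [K N] are bounded by
   [size zs] times a piece of the tail of [series a]. *)
have [M NM AM] : exists2 M, (N <= M)%N & forall x, x \in A -> x \in K M.
  have [m hm] : exists m : C -> nat, forall x, exists z, [/\ z \in zs, J (m x) & x = c z (m x)].
    have /choice[m hm] : forall x, exists n, exists z, [/\ z \in zs, J n & x = c z n].
      by move=> x; have [z [n h]] := csurj x; exists n, z.
    by exists m.
  exists (N + \sum_(x <- A) (m x).+1)%N; first exact: leq_addr.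
  move=> x xA; apply/memK; have [z [zz Jm xc]] := hm x.
  exists z, (m x); split=> //; apply: (@leq_trans (\sum_(x <- A) (m x).+1)); last exact: leq_addl.
  by rewrite (big_rem x)//= leq_addr.
have subK x : x \in K N -> x \in K M.
  by move=> /memK[z [n [zz Jn nN ->]]]; apply/memK; exists z, n; split => //; exact: leq_trans NM.
have -> : partial_sum t A = \sum_(x <- K M | x \in A) t x.
  rewrite /partial_sum -(big_seq_fsetE _ A xpredT t)/= -[RHS]big_filter.
  apply: perm_big; apply: uniq_perm; rewrite ?filter_uniq ?fset_uniq// => x.
  by rewrite mem_filter andb_idr// => /AM.
have KNM (V' : zmodType) (phi : C -> V') :
    \sum_(x <- K N) phi x = \sum_(x <- K M | x \in K N) phi x.
  rewrite -[RHS]big_filter; apply: perm_big; apply: uniq_perm; rewrite ?filter_uniq// => x.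
  by rewrite mem_filter andb_idr// => /subK.
rewrite (bigID (fun x => x \in K N))/=.
have -> : \sum_(x <- K M | (x \in A) && (x \in K N)) t x = series u N *+ size zs.
  rewrite -(sumK _ t)// KNM; apply: eq_bigl => x; rewrite andb_idl// => xK.
  by apply: KA; rewrite inE.
rewrite -(mulr_natl (series u N)) addrAC -mulrBr; apply: (le_lt_trans (cabsD _ _)).
rewrite [e]splitr; apply: ltr_leD.
  rewrite cabsM -(rmorph_nat (real_complex R)) cabs_real//.
  by apply: le_lt_trans (dle _ _) _; rewrite ?cabs_ge0// -ltr_pdivlMl// mulrC.
apply: (le_trans (cabs_sum _ _ _)).
apply: (@le_trans _ _ (\sum_(x <- K M | x \notin K N) cabs (t x))).
  rewrite [leRHS](bigID (fun x => x \in A))/= [X in X + _](eq_bigl (fun x => (x \in A) && (x \notin K N))).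
    by rewrite lerDl sumr_ge0// => *; exact: cabs_ge0.
  by move=> x; rewrite andbC.
have tot : \sum_(x <- K M) cabs (t x) =
    \sum_(x <- K N) cabs (t x) + \sum_(x <- K M | x \notin K N) cabs (t x).
  by rewrite KNM [LHS](bigID (fun x => x \in K N)).
have ta z n : z \in zs -> J n -> cabs (t (c z n)) = a n by move=> ? ?; rewrite /a tu.
have a0 n : ~~ J n -> a n = 0 by move=> /u0; rewrite /a => ->; rewrite cabs0.
move: tot; rewrite !(sumK _ _ a)// => tot.
have -> : \sum_(x <- K M | x \notin K N) cabs (t x) = (series a M - series a N) *+ size zs.
  by rewrite mulrnBl tot addrC addKr.
rewrite -(mulr_natl (series a M - series a N)).
apply: (@le_trans _ _ ((size zs).+1%:R * (series a M - series a N))).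
  by apply: dle; rewrite subr_ge0; exact: nda.
rewrite -ler_pdivlMl// mulrC; apply: le_trans (ltW h2).
by apply: le_trans (ler_norm _); rewrite lerB.
Unshelve. all: by end_near. Qed.

End unordered_sums.

(** Greedy selection: an element is added exactly when it is related to none of those already
    kept. *)
Lemma choose_representatives (T : eqType) (r : T -> T -> Prop) (A : seq T) :
  (forall x, r x x) -> (forall x y, r x y -> r y x) ->
  exists B : seq T, [/\ uniq B, {subset B <= A},
    forall x, x \in A -> exists2 y, y \in B & r x y &
    forall x y, x \in B -> y \in B -> r x y -> x = y].
Proof.
move=> rr rs; elim: A => [|a A [B [uB BA AB inj]]]; first by exists [::].
have [[y yB ay]|na] := pselect (exists2 y, y \in B & r a y).
  exists B; split => // [x /BA xA|x]; first by rewrite inE xA orbT.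
  by rewrite inE => /orP[/eqP ->|/AB//]; exists y.
exists (a :: B); split => /=.
- by rewrite uB andbT; apply/negP => aB; apply: na; exists a.
- by move=> x; rewrite !inE => /orP[->//|/BA ->]; rewrite orbT.
- move=> x; rewrite inE => /orP[/eqP ->|/AB[y yB xy]].
    by exists a => //; rewrite mem_head.
  by exists y => //; rewrite inE yB orbT.
- move=> x y; rewrite !inE => /orP[/eqP ->|xB] /orP[/eqP ->|yB]// xy.
  + by exfalso; apply: na; exists y.
  + by exfalso; apply: na; exists x => //; exact: rs.
  + exact: inj.
Qed.

(** * Elements acting trivially and their classes modulo Lambda *)

Section groups.
Variable R : realType.
Implicit Types (s t : mp R) (G L : set (mp R)).

Lemma mp_trivial1 : mp_trivial (1%g : mp R).
Proof. by move=> z _; exact: mp_act1. Qed.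

Lemma mp_trivialV s : mp_trivial s -> mp_trivial s^-1%g.
Proof. by move=> sT z z0; rewrite -{1}(sT z z0) -mp_actM// mulVg mp_act1. Qed.

Lemma mp_trivialM s t : mp_trivial s -> mp_trivial t -> mp_trivial (s * t)%g.
Proof. by move=> sT tT z z0; rewrite mp_actM// tT// sT. Qed.

Lemma mp_trivial_hact s p : mp_trivial s -> hact s p = p.
Proof.
move=> sT; have [p0|p0] := pselect (half_plane p); last by rewrite hactN.
by rewrite hactE// sT// toCK.
Qed.

Lemma mp_trivialC s t : mp_trivial s -> (s * t = t * s)%g.
Proof. by move=> /mp_trivial_center; exact. Qed.

Lemma mp_ntrivial s : ~ mp_trivial s -> exists2 z, uhp z & mp_act s z != z.
Proof.
move=> sT; apply: contrapT => h; apply: sT => z z0; apply: contrapT => /eqP sz.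
by apply: h; exists z.
Qed.

Lemma mp_trivial_list : exists A : seq (mp R), forall s, mp_trivial s -> s \in A.
Proof.
(* An element acting trivially is determined by e and eta(i). Pairs that come from no element yield
   the default 1, which only adds a repetition to the list. *)
pose sel (e : R) (h : R[i]) : mp R := xget 1%g [set s | [/\ mp_trivial s, mp_mx s = e%:M & mp_eta s 'i%C = h]].
exists [seq sel e h | e <- [:: 1; -1], h <- [:: 1; -1; 'i%C; - 'i%C]] => s sT.
have [e e1 se] := mp_trivialP sT.
have h2 : mp_eta s 'i%C ^+ 2 = e%:C.
  by rewrite (mp_eta2 s (uhp_i R)) se /autom !mxE /= mulr0n mulr1n mul0r add0r.
have -> : s = sel e (mp_eta s 'i%C).
  rewrite /sel; case: xgetP => [t _ [tT te ti]|/(_ s)]; last by case; split.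
  apply: mp_eq => [|z z0]; first by rewrite te.
  by rewrite (mp_eta_trivial sT z0 (uhp_i R)) (mp_eta_trivial tT z0 (uhp_i R)).
have ii : 'i%C ^+ 2 = -1 :> R[i].
  by apply/eqP; rewrite expr2 eq_complex/= !mul0r !mulr0 mulr1 sub0r addr0 oppr0 !eqxx.
apply: allpairs_f; first by rewrite !inE -sqrf_eq1 e1.
have : (e == 1) || (e == -1) by rewrite -sqrf_eq1 e1.
move=> /orP[]/eqP ee; move: h2; rewrite ee.
  by move=> /eqP; rewrite sqrf_eq1 !inE => /orP[]->; rewrite ?orbT.
rewrite (_ : (-1)%:C = 'i%C ^+ 2); last by rewrite ii rmorphN.
by move=> /eqP; rewrite eqf_sqr !inE => /orP[]->; rewrite ?orbT.
Qed.

(** Numbers that code no element are sent to 1, so the enumeration is total, with possible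
    repetitions; [least_rep] will discard these. *)
Lemma mp_enumeration G : mp_subgroup G -> mp_discrete G ->
  exists g : nat -> mp R, (forall n, G (g n)) /\ (forall s, G s -> exists n, g n = s).
Proof.
move=> [G1 _ _] /mp_discrete_countable/countable_injP[c cinj].
exists (fun n => xget 1%g [set s | G s /\ c s = n]); split=> [n|s Gs].
  by case: xgetP => // s _ [].
exists (c s); case: xgetP => [t _ [Gt ct]|/(_ s)]; last by case.
by apply: cinj => //; exact: mem_set.
Qed.

(** The length of [zs] is the number of Lambda-cosets in each class of Lambda Z(Gamma) \ Gamma, that
    is, the block size in the Poincare series. *)
Lemma trivial_representatives G L : mp_subgroup G -> mp_subgroup L -> L `<=` G ->
  exists zs : seq (mp R), [/\ uniq zs,
    forall z, z \in zs -> G z /\ mp_trivial z,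
    forall z, G z -> mp_trivial z -> exists2 y, y \in zs & L (z * y^-1)%g &
    forall x y, x \in zs -> y \in zs -> L (x * y^-1)%g -> x = y].
Proof.
move=> Gsub [L1 LM LV] LG; have [A At] := mp_trivial_list.
pose A' := [seq s <- A | `[< G s /\ mp_trivial s >]].
have [|x y|zs [uz zA Az inj]] := @choose_representatives _ (fun s t => L (s * t^-1)%g) A'.
- by move=> x; rewrite mulgV.
- by move=> /LV; rewrite invgM invgK.
exists zs; split=> // [z /zA|z Gz zT]; first by rewrite mem_filter => /andP[/asboolP].
by apply: Az; rewrite mem_filter At// andbT; apply/asboolP.
Qed.

End groups.

(** * Unfolding *)

Section unfolding.
Local Open Scope ereal_scope.
Variable R : realType.
Implicit Types (A : set (R * R)) (th : R * R -> \bar R).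

Lemma hact_image (s : mp R) A : hact s @` A = hact s^-1%g @^-1` A.
Proof.
apply/seteqP; split=> [_ [p Ap <-]|p Ap]; first by rewrite /preimage/= hactK.
by exists (hact s^-1%g p) => //; rewrite hactVK.
Qed.

Lemma measurable_hact_image (s : mp R) A : measurable A -> measurable (hact s @` A).
Proof.
move=> mA; rewrite hact_image -[_ @^-1` _]setTI.
exact: (hact_preserving s^-1%g).1.
Qed.

Lemma ge0_integral_hact (s : mp R) A th : measurable A ->
  measurable_fun setT th -> (forall p, 0 <= th p) ->
  \int[@hmeas R]_(p in A) th (hact s p) = \int[@hmeas R]_(p in hact s @` A) th p.
Proof.
move=> mA mth th0; rewrite integral_mkcond [RHS]integral_mkcond.
have mhA := measurable_hact_image s mA.
rewrite -[RHS](hact_preserving s).2.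
- apply: eq_integral => p _; rewrite !patchE; congr (if _ then _ else _).
  rewrite hact_image; apply/idP/idP; rewrite !inE /preimage/= hactK//.
- by apply/(measurable_restrictT th mhA); exact: measurable_funTS.
- by move=> p; rewrite patchE; case: ifP.
Qed.

(** Invariance turns each term into an integral over a translate of [A]; the last hypothesis says
    that the translates are pairwise disjoint, so that these integrals add up. *)
Lemma unfolding (s : nat -> mp R) (D : set nat) A th : measurable A ->
  measurable_fun setT th -> (forall p, 0 <= th p) ->
  (forall n m p q, D n -> D m -> A p -> A q -> hact (s n) p = hact (s m) q -> n = m) ->
  \int[@hmeas R]_(p in A) (\sum_(n <oo) if `[< D n >] then th (hact (s n) p) else 0) =
  \int[@hmeas R]_(p in \bigcup_(n in D) hact (s n) @` A) th p.
Proof.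
move=> mA mth th0 inj.
pose F n := if `[< D n >] then hact (s n) @` A else set0.
rewrite (_ : \bigcup_(n in D) _ = \bigcup_n F n); last first.
  apply/seteqP; split=> [p [n Dn Ap]|p [n _]]; rewrite /F.
    by exists n => //; rewrite asboolT.
  by case: ifP => // /asboolP Dn Ap; exists n.
have mF n : measurable (F n).
  by rewrite /F; case: ifP => // _; exact: measurable_hact_image.
rewrite integral_nneseries//; last 2 first.
- move=> n; have [Dn|Dn] := pselect (D n); [rewrite asboolT//|by rewrite asboolF].
  apply: measurable_funTS; exact: (measurableT_comp mth (hact_preserving (s n)).1).
- by move=> n p _; case: ifP.
rewrite ge0_integral_bigcup//; last 2 first.
- exact: measurable_funTS.
- move=> n m _ _ [p []]; rewrite /F; case: ifP => // /asboolP Dn [q Aq <-].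
  by case: ifP => // /asboolP Dm [q' Aq' e]; apply: (inj n m q q').
apply: eq_eseriesr => n _; rewrite /F.
have [Dn|Dn] := pselect (D n); first by rewrite asboolT// ge0_integral_hact.
by rewrite asboolF//= integral0 integral_set0.
Qed.

End unfolding.

(** * Generic points: a conull invariant set without exceptions *)

Section generic_points.
Variable R : realType.
Implicit Types (s : mp R) (G L : set (mp R)) (A : set (R * R)).

Lemma hnull_hmeas (E : set R[i]) : hnull E -> (@hmeas R).-negligible (@toC R @^-1` E).
Proof. exact: negligible_hmeas. Qed.

Lemma saturation_hact L (E : set R[i]) p : mp_subgroup L -> half_plane p -> E `<=` uhp ->
  mp_saturation L E (toC p) -> exists2 l, L l & E (toC (hact l p)).
Proof.
move=> [_ _ LV] p0 EH [w Ew [l Ll lw]]; exists l^-1%g; first exact: LV.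
rewrite toC_hact// -lw -mp_actM ?mulVg ?mp_act1//; exact: EH.
Qed.

(* The conditions defining fundamental domains, and freeness modulo the elements
   acting trivially, hold exactly at a generic point and not just up to null sets. *)
Definition generic G L (FG FL : set R[i]) (p : R * R) :=
  [/\ forall s, G s -> hact s p = p -> mp_trivial s,
      exists2 l, L l & FL (toC (hact l p)),
      forall l, L l -> FL (toC p) -> FL (toC (hact l p)) -> mp_trivial l &
      exists2 s, G s & FG (toC (hact s p))].

(** All exceptions form the null set [N0]. Removing the countably many Gamma-translates of a
    measurable null set [B] containing it leaves [A] measurable, conull and Gamma-invariant. *)
Lemma generic_points G L (FG FL : set R[i]) : mp_subgroup G -> mp_discrete G ->
  mp_subgroup L -> L `<=` G -> fundamental_domain G FG -> fundamental_domain L FL ->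
  exists A, [/\ measurable A, A `<=` @half_plane R,
    (@hmeas R).-negligible (@half_plane R `\` A),
    forall s p, G s -> A p -> A (hact s p) &
    forall p, A p -> generic G L FG FL p].
Proof.
move=> Gsub Gd Lsub LG [FGH _ FGc _] [FLH _ FLc FLd].
have [g [Gg gG]] := mp_enumeration Gsub Gd.
have [G1 GM GV] := Gsub; have [L1 LM LV] := Lsub.
pose fixd n := if `[< mp_trivial (g n) >] then set0
  else [set p | half_plane p /\ hact (g n) p = p].
pose over n := if `[< L (g n) /\ ~ mp_trivial (g n) >]
  then @toC R @^-1` (FL `&` mp_act (g n) @` FL) else set0.
pose N0 := (\bigcup_n fixd n) `|` (\bigcup_n over n) `|`
  (@toC R @^-1` (uhp `\` mp_saturation L FL)) `|`
  (@toC R @^-1` (uhp `\` mp_saturation G FG)).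
have [B [mB B0 NB]] : (@hmeas R).-negligible N0.
  apply: negligibleU; last exact: hnull_hmeas.
  apply: negligibleU; last exact: hnull_hmeas.
  apply: negligibleU; apply: negligible_bigcup => n.
    rewrite /fixd; case: asboolP => sT; first exact: negligible_set0.
    exact/negligible_fixed/mp_ntrivial.
  rewrite /over; case: asboolP => [[Ln sT]|_]; last exact: negligible_set0.
  by apply: hnull_hmeas; apply: FLd => //; exact: mp_ntrivial.
pose A := @half_plane R `\` \bigcup_n (hact (g n) @^-1` B).
have mgB n : measurable (hact (g n) @^-1` B).
  by rewrite -[_ @^-1` _]setTI; exact: (hact_preserving (g n)).1.
have AG s p : G s -> A p -> A (hact s p).
  move=> Gs [p0 pB]; split; first exact: hact_half_plane.
  move=> [n _]; rewrite /preimage/= -hactM => h; apply: pB.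
  have [m gm] := gG _ (GM _ _ (Gg n) Gs).
  by exists m => //; rewrite /preimage/= gm.
have AN p : A p -> ~ N0 p.
  move=> [p0 pB] /NB Bp; apply: pB; have [n gn] := gG _ G1.
  by exists n => //; rewrite /preimage/= gn hact1.
exists A; split => //.
- apply: measurableD; first exact: measurable_half_plane.
  exact: bigcupT_measurable.
- by move=> p [].
- have nB : (@hmeas R).-negligible (\bigcup_n (hact (g n) @^-1` B)).
    by apply: negligible_bigcup => n; apply: negligible_hact; apply/negligibleP.
  apply: negligibleS nB => p [p0 pA]; apply: contrapT => h; exact: pA.
move=> p Ap; have p0 : half_plane p by case: Ap.
have Np := AN _ Ap; split.
- move=> s Gs sp; apply: contrapT => sT; apply: Np; do 3 left.
  by have [n gn] := gG _ Gs; exists n => //; rewrite /fixd gn asboolF.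
- apply: saturation_hact => //; apply: contrapT => h; apply: Np; left; right.
  by split.
(* The overlap of [FL] with its translate by [l] contains l p rather than p, so the invariance of
   [A] is used. *)
- move=> l Ll Fp Flp; apply: contrapT => lT; apply: (AN (hact l p)).
    by apply: AG => //; exact: LG.
  do 2 left; right; have [n gn] := gG _ (LG _ Ll); exists n => //.
  rewrite /over gn asboolT//; split => //=.
  by exists (toC p) => //; rewrite toC_hact.
- by apply: saturation_hact => //; apply: contrapT => h; apply: Np; right; split.
Qed.

End generic_points.

(** * Measurability of complex functions *)

Section complex_measurable.
Context d (T : measurableType d) (R : realType).
Implicit Types (D : set T) (h : T -> R[i]).

Definition measurable_funC D h :=
  measurable_fun D (fun p => complex.Re (h p)) /\
  measurable_fun D (fun p => complex.Im (h p)).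

Lemma measurable_funC_cst D (a : R[i]) : measurable_funC D (fun=> a).
Proof. by split; exact: measurable_cst. Qed.

Lemma measurable_funCD D h1 h2 : measurable_funC D h1 -> measurable_funC D h2 ->
  measurable_funC D (fun p => h1 p + h2 p).
Proof.
move=> [r1 i1] [r2 i2]; split.
  by under eq_fun do rewrite raddfD/=; exact: measurable_funD.
by under eq_fun do rewrite raddfD/=; exact: measurable_funD.
Qed.

Lemma ReM (z w : R[i]) : complex.Re (z * w) =
  complex.Re z * complex.Re w - complex.Im z * complex.Im w.
Proof. by case: z w => a b []. Qed.

Lemma ImM (z w : R[i]) : complex.Im (z * w) =
  complex.Re z * complex.Im w + complex.Im z * complex.Re w.
Proof. by case: z w => a b []. Qed.

Lemma measurable_funCM D h1 h2 : measurable_funC D h1 -> measurable_funC D h2 ->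
  measurable_funC D (fun p => h1 p * h2 p).
Proof.
move=> [r1 i1] [r2 i2]; split.
  by under eq_fun do rewrite ReM; apply: measurable_funB; exact: measurable_funM.
by under eq_fun do rewrite ImM; apply: measurable_funD; exact: measurable_funM.
Qed.

Lemma measurable_funCX D h n : measurable_funC D h -> measurable_funC D (fun p => h p ^+ n).
Proof.
move=> mh; elim: n => [|n IH].
  by under eq_fun do rewrite expr0; exact: measurable_funC_cst.
by under eq_fun do rewrite exprS; exact: measurable_funCM.
Qed.

Lemma measurable_funCV D h : measurable_funC D h -> measurable_funC D (fun p => (h p)^-1).
Proof.
move=> [mr mi].
have mn : measurable_fun D (fun p => (complex.Re (h p) ^+ 2 + complex.Im (h p) ^+ 2)^-1).
  apply: measurableT_comp; first exact: measurable_inv.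
  by apply: measurable_funD; exact: measurable_funX.
split.
  rewrite (_ : (fun _ => _) = fun p =>
    complex.Re (h p) * (complex.Re (h p) ^+ 2 + complex.Im (h p) ^+ 2)^-1).
    exact: measurable_funM.
  by apply/funext => p; case: (h p).
rewrite (_ : (fun _ => _) = fun p =>
  - (complex.Im (h p) * (complex.Re (h p) ^+ 2 + complex.Im (h p) ^+ 2)^-1)).
  by apply: measurable_funN; exact: measurable_funM.
by apply/funext => p; case: (h p).
Qed.

Lemma measurable_funC_sum D (I : Type) (r : seq I) (F : I -> T -> R[i]) :
  (forall i, measurable_funC D (F i)) -> measurable_funC D (fun p => \sum_(i <- r) F i p).
Proof.
move=> mF; elim: r => [|i r IH].
  by under eq_fun do rewrite big_nil; exact: measurable_funC_cst.
by under eq_fun do rewrite big_cons; exact: measurable_funCD.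
Qed.

Lemma measurable_cabs D h : measurable_funC D h -> measurable_fun D (fun p => cabs (h p)).
Proof.
move=> [mr mi]; under eq_fun do rewrite cabs_def.
apply: measurableT_comp; first by apply: continuous_measurable_fun; exact: sqrt_continuous.
by apply: measurable_funD; exact: measurable_funX.
Qed.

Lemma measurable_funC_if D (E : set T) h : measurable D -> measurable E ->
  measurable_funC D h -> measurable_funC D (fun p => if p \in E then h p else 0).
Proof.
move=> mD mE [mr mi].
have aux (pr : R[i] -> R) : pr 0 = 0 -> measurable_fun D (fun p => pr (h p)) ->
    measurable_fun D (fun p => pr (if p \in E then h p else 0)).
  move=> pr0 m; rewrite (_ : (fun _ => _) = fun p => \1_E p * pr (h p)).
    by apply: measurable_funM => //; apply: measurable_indic.
  by apply/funext => p; rewrite indicE; case: ifP; rewrite ?mul1r ?mul0r.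
by split; apply: aux.
Qed.

End complex_measurable.

Section half_plane_measurable.
Variable R : realType.

Lemma measurable_hact_half_plane (s : mp R) d (T : measurableType d) (h : R * R -> T) :
  measurable_fun (@half_plane R) h -> measurable_fun (@half_plane R) (h \o hact s).
Proof.
move=> mh; apply: (measurable_comp _ _ mh); first exact: measurable_half_plane.
  by move=> _ [p p0 <-]; exact: hact_half_plane.
by apply: measurable_funTS; exact: (hact_preserving s).1.
Qed.

Lemma measurable_slash k (f : R[i] -> R[i]) (s : mp R) : borel_funC uhp f ->
  measurable_funC (@half_plane R) (fun p => slash k f s (toC p)).
Proof.
move=> mf; rewrite /slash; apply: measurable_funCM; last first.
  apply/measurable_funCV/measurable_funCX; apply: derivable_borel => z z0.
  exact: mp_holo.
have mD : measurable (@half_plane R) by exact: measurable_half_plane.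
have aux (pr : R[i] -> R) : measurable_fun (@half_plane R) (fun p => pr (f (toC p))) ->
    measurable_fun (@half_plane R) (fun p => pr (f (mp_act s (toC p)))).
  move=> m; apply: eq_measurable_fun (measurable_hact_half_plane s m).
  by move=> p; rewrite inE => p0 /=; rewrite toC_hact.
by split; apply: aux; [exact: mf.1|exact: mf.2].
Qed.

Definition hpow (k : nat) (p : R * R) : R := p.2 `^ (weight R k / 2).

Lemma measurable_hpow k D : measurable_fun D (hpow k).
Proof.
apply: measurable_funTS.
apply: (@measurableT_comp _ _ _ _ _ _ (@powR R ^~ (weight R k / 2)) setT snd).
  exact: measurable_powR.
exact: measurable_snd.
Qed.

Lemma hpow_gt0 k p : half_plane p -> 0 < hpow k p.
Proof. exact: powR_gt0. Qed.

Lemma normalizedE k (f : R[i] -> R[i]) p : normalized k f (toC p) = f (toC p) * (hpow k p)%:C.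
Proof. by []. Qed.

Lemma measurable_normalized k (f : R[i] -> R[i]) : borel_funC uhp f ->
  measurable_funC (@half_plane R) (fun p => normalized k f (toC p)).
Proof.
move=> mf; apply: measurable_funCM => //.
by split; [exact: measurable_hpow|exact: measurable_cst].
Qed.

Lemma measurable_comp_normalized k (f : R[i] -> R[i]) (rho : R[i] -> R) :
  borel_funC uhp f -> borel_funCR rho ->
  measurable_fun (@half_plane R) (fun p => rho (normalized k f (toC p))).
Proof.
move=> /(measurable_normalized k)[mr mi] mrho.
have mD : measurable (@half_plane R) by exact: measurable_half_plane.
have mh := measurable_fun_pair ((measurable_restrictT _ mD).1 mr) ((measurable_restrictT _ mD).1 mi).
apply: eq_measurable_fun (measurable_funTS (measurableT_comp mrho mh)).
by move=> p pD /=; rewrite !patchE pD; case: (normalized k f (toC p)).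
Qed.

End half_plane_measurable.

Section reindexing.
Variable R : realType.

Lemma partial_sum_reindex (C C' : choiceType) (phi : C' -> C) (psi : C -> C')
    (t : C -> R[i]) (t' : C' -> R[i]) (a V : R[i]) :
  cancel phi psi -> cancel psi phi -> (forall x, t' x = a * t (phi x)) ->
  partial_sum t @ totally --> V -> partial_sum t' @ totally --> a * V.
Proof.
move=> phiK psiK tt' tV.
have FF : ProperFilter (@totally C) by exact: totally_filter.
have FF' : ProperFilter (@totally C') by exact: totally_filter.
apply/cvg_cabsP => e e0; have a0 : 0 < cabs a + 1 by rewrite ltr_wpDl// cabs_ge0.
move/cvg_cabsP : tV => /(_ _ (divr_gt0 e0 a0))[K _ hK].
exists [fset psi x | x in K]%fset => // A /= /fsubsetP KA.
have /hK : (K `<=` [fset phi x | x in A])%fset.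
  apply/fsubsetP => x xK; apply/imfsetP; exists (psi x) => //=.
  by apply: KA; apply/imfsetP; exists x.
have <- : a * partial_sum t [fset phi x | x in A]%fset = partial_sum t' A.
  rewrite /partial_sum -(big_seq_fsetE _ A xpredT t')/= -(big_seq_fsetE _ _ xpredT t)/=.
  rewrite big_imfset/=; last by move=> x y _ _; exact: (can_inj phiK).
  by rewrite mulr_sumr; apply: eq_bigr => x _.
rewrite -mulrBr cabsM ltr_pdivlMr// mulrC; apply: le_lt_trans.
by rewrite ler_wpM2r ?cabs_ge0// lerDl.
Qed.

Lemma partial_sum_lim (C : choiceType) (t : C -> R[i]) (V : R[i]) :
  partial_sum t @ totally --> V -> lim (partial_sum t @ totally) = V.
Proof.
have FF : ProperFilter (@totally C) by exact: totally_filter.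
by move=> tV; apply: cvg_lim => //; exact: norm_hausdorff.
Qed.

End reindexing.

(** * The Poincare series as a sum over selected representatives *)

Section coset_sums.
Variable R : realType.
Variables (G L : set (mp R)) (chi : mp R -> R[i]) (k : nat) (f : R[i] -> R[i]).
Hypotheses (Gsub : mp_subgroup G) (Lsub : mp_subgroup L) (LG : L `<=` G).
Hypothesis chiU : unitary_character G chi.
Hypothesis f1 : forall l z, L l -> uhp z -> slash k f l z = chi l * f z.
Hypothesis chiZ : central_character G chi (weight R k).

Let G1 : G 1%g. Proof. by case: Gsub. Qed.
Let GM s t : G s -> G t -> G (s * t)%g. Proof. by case: Gsub => _ h _; exact: h. Qed.
Let GV s : G s -> G s^-1%g. Proof. by case: Gsub => _ _; exact. Qed.
Let L1 : L 1%g. Proof. by case: Lsub. Qed.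
Let LM s t : L s -> L t -> L (s * t)%g. Proof. by case: Lsub => _ h _; exact: h. Qed.
Let LV s : L s -> L s^-1%g. Proof. by case: Lsub => _ _; exact. Qed.

(** Sends elements outside Gamma to 1, so that [mp_rcoset] is a total map into the type of
    cosets. *)
Let rep (s : mp R) := if `[< G s >] then s else 1%g.

Let rcoset_in s : mp_rcosets L G [set (l * rep s)%g | l in L].
Proof. by exists (rep s) => //; rewrite /rep; case: asboolP. Qed.

Definition mp_rcoset s : mp_rcosets L G := SigSub (mem_set (rcoset_in s)).

Lemma val_mp_rcoset s : G s -> val (mp_rcoset s) = [set (l * s)%g | l in L].
Proof. by move=> Gs; rewrite /= /rep asboolT. Qed.

Lemma mp_rcoset_eq s t : G s -> G t -> mp_rcoset s = mp_rcoset t <-> L (s * t^-1)%g.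
Proof.
move=> Gs Gt; split=> [/(congr1 val)|Lst].
  rewrite !val_mp_rcoset// => e; have [l Ll <-] : [set (l * t)%g | l in L] s.
    by rewrite -e; exists 1%g; rewrite ?mul1g.
  by rewrite -mulgA mulgV mulg1.
apply: val_inj; rewrite !val_mp_rcoset//; apply/seteqP; split=> _ [l Ll <-].
  by exists (l * (s * t^-1))%g; [exact: LM|rewrite -!mulgA mulVg mulg1].
exists (l * (t * s^-1))%g; last by rewrite -!mulgA mulVg mulg1.
by apply: LM => //; have := LV Lst; rewrite invgM invgK.
Qed.

Lemma mp_rcosetP (c : mp_rcosets L G) : exists2 s, G s & c = mp_rcoset s.
Proof.
case: c => c cP; have [s Gs sc] := set_mem cP; exists s => //.
by apply: val_inj; rewrite val_mp_rcoset.
Qed.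

Definition coset_term z (c : mp_rcosets L G) : R[i] := term chi k f (xget 1%g (val c)) z.

Lemma coset_termE z s : G s -> uhp z -> coset_term z (mp_rcoset s) = term chi k f s z.
Proof.
move=> Gs z0; rewrite /coset_term val_mp_rcoset//.
case: xgetP => [_ _ [l Ll <-]|/(_ s)]; first exact: (term_mull LG chiU).
by case; exists 1%g; rewrite ?mul1g.
Qed.

Lemma poincareE z : poincare k L G chi f z = lim (partial_sum (coset_term z) @ totally).
Proof. by []. Qed.

(** Right multiplication by [s] permutes the cosets, and by [term_mulr] it multiplies the terms by a
    common factor. *)
Lemma coset_sum_act s z (V : R[i]) : G s -> uhp z ->
  partial_sum (coset_term z) @ totally --> V ->
  partial_sum (coset_term (mp_act s z)) @ totally -->
    chi s * mp_eta s z ^+ (2 * k + 1) * V.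
Proof.
move=> Gs z0; pose mulr t (c : mp_rcosets L G) := mp_rcoset (xget 1%g (val c) * t)%g.
have mulrE r t : G r -> G t -> mulr t (mp_rcoset r) = mp_rcoset (r * t)%g.
  move=> Gr Gt; rewrite /mulr val_mp_rcoset//.
  case: xgetP => [_ _ [l Ll <-]|/(_ r)]; last by case; exists 1%g; rewrite ?mul1g.
  apply/mp_rcoset_eq; rewrite ?invgM ?mulgA; do ?[exact: GM | exact: LG].
  - by do 2 apply: GM => //; exact: LG.
  - by rewrite mulgK mulgK.
have Gs' := GV Gs.
apply: (@partial_sum_reindex _ _ _ (mulr s) (mulr s^-1%g)).
- move=> c; have [r Gr ->] := mp_rcosetP c.
  by rewrite mulrE// (mulrE _ _ (GM Gr Gs) Gs') mulgK.
- move=> c; have [r Gr ->] := mp_rcosetP c.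
  by rewrite mulrE// (mulrE _ _ (GM Gr Gs') Gs) mulgVK.
move=> c; have [r Gr ->] := mp_rcosetP c; rewrite mulrE// !coset_termE//.
- exact: (term_mulr _ _ chiU).
- exact: GM.
- exact: mp_act_uhp.
Qed.

(** Convergence is assumed because [lim] is otherwise arbitrary, and convergence at z entails it on
    the whole orbit. *)
Lemma poincare_act s z (V : R[i]) : G s -> uhp z ->
  partial_sum (coset_term z) @ totally --> V ->
  cabs (normalized k (poincare k L G chi f) (mp_act s z)) =
  cabs (normalized k (poincare k L G chi f) z).
Proof.
move=> Gs z0 zV; rewrite cabs_normalized_act// /slash.
rewrite !poincareE (partial_sum_lim (coset_sum_act Gs z0 zV)).
rewrite /normalized poincareE (partial_sum_lim zV) !cabsM.
have -> : cabs (chi s) = 1 by apply: (@complexI R); rewrite cabsE chiU.2.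
rewrite (cabs_real (powR_ge0 _ _)) cabsV; congr (_ * _).
have n0 : cabs (mp_eta s z ^+ (2 * k + 1)) != 0 by rewrite cabs_eq0 expf_neq0// mp_eta_neq0.
by rewrite mul1r mulrC mulKf.
Qed.

Variables (FG FL : set R[i]) (A : set (R * R)).
Hypotheses (AH : A `<=` @half_plane R)
  (AG : forall s p, G s -> A p -> A (hact s p))
  (Agen : forall p, A p -> generic G L FG FL p).
Variable g : nat -> mp R.
Hypotheses (Gg : forall n, G (g n)) (gG : forall s, G s -> exists n, g n = s).

(* g n is the first element of its class modulo the elements acting trivially. *)
Definition least_rep n := forall j, (j < n)%N -> ~ mp_trivial (g n * (g j)^-1)%g.

Lemma least_rep_exists s : G s -> exists2 n, least_rep n & mp_trivial (g n * s^-1)%g.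
Proof.
move=> Gs; have ex : exists n, `[< mp_trivial (g n * s^-1)%g >].
  by have [n gn] := gG Gs; exists n; apply/asboolP; rewrite gn mulgV; exact: mp_trivial1.
case: (ex_minnP ex) => n /asboolP ns nmin; exists n => // j jn jT.
have : (n <= j)%N.
  apply: nmin; apply/asboolP; rewrite (_ : (_ * _)%g = (g n * (g j)^-1)^-1 * (g n * s^-1))%g.
    by apply: mp_trivialM => //; exact: mp_trivialV.
  by rewrite invgM invgK -!mulgA mulKg.
by rewrite leqNgt jn.
Qed.

Lemma least_rep_inj n m : least_rep n -> least_rep m ->
  mp_trivial (g n * (g m)^-1)%g -> n = m.
Proof.
move=> In Im nm; case: (ltngtP n m) => // h; exfalso.
  apply: (Im n h); have -> : (g m * (g n)^-1 = (g n * (g m)^-1)^-1)%g by rewrite invgM invgK.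
  exact: mp_trivialV.
exact: (In m h).
Qed.

(* For generic p, exactly one index is selected in each class of
   Lambda Z(Gamma) \ Gamma: the one that moves p into FL. This choice of
   representatives depends on p, but measurably. *)
Definition selected p n : bool := `[< least_rep n /\ FL (toC (hact (g n) p)) >].

Definition selected_term p n : R[i] :=
  if selected p n then term chi k f (g n) (toC p) else 0.

Variable zs : seq (mp R).
Hypotheses (zs_uniq : uniq zs)
  (zsG : forall z, z \in zs -> G z /\ mp_trivial z)
  (zs_ex : forall z, G z -> mp_trivial z -> exists2 y, y \in zs & L (z * y^-1)%g)
  (zs_inj : forall x y, x \in zs -> y \in zs -> L (x * y^-1)%g -> x = y).

(** At a generic point every coset is that of z * g n for exactly one z in [zs] and one selected n,
    and its term does not depend on z. *)
Lemma coset_sum_selected p (U : R[i]) : A p ->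
  cvgn (series (fun n => cabs (selected_term p n))) ->
  series (selected_term p) @ \oo --> U ->
  partial_sum (coset_term (toC p)) @ totally --> (size zs)%:R * U.
Proof.
move=> Ap; have p0 := AH Ap.
apply: (@cvg_partial_sum_blocks _ _ _ zs (selected p) (fun z n => mp_rcoset (z * g n)%g)) => //.
- move=> z z' n n' zz zz' /asboolP[In Fn] /asboolP[In' Fn'].
  have [Gz zT] := zsG zz; have [Gz' zT'] := zsG zz'.
  move=> /mp_rcoset_eq - /(_ (GM Gz (Gg n)) (GM Gz' (Gg n'))) Ll.
  set l := (z * g n * (z' * g n')^-1)%g in Ll.
  have gl : (z * g n = l * (z' * g n'))%g by rewrite /l -[RHS]mulgA mulVg mulg1.
  have hn : hact (g n) p = hact l (hact (g n') p).
    rewrite -[LHS](mp_trivial_hact _ zT) -hactM gl !hactM.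
    by rewrite (mp_trivial_hact _ zT').
  have [_ _ Lfree _] := Agen (AG (Gg n') Ap).
  (* Both [g n] and [g n'] move p into [FL], so the element of Lambda relating their cosets acts
     trivially, and the two indices lie in one class. *)
  have lT : mp_trivial l by apply: Lfree => //; rewrite -hn.
  have nn : n = n'.
    apply: least_rep_inj => //; rewrite (_ : (_ * _)%g = (z^-1 * l * z'))%g.
      by apply: mp_trivialM => //; apply: mp_trivialM => //; exact: mp_trivialV.
    rewrite -(mulKg z (g n)) gl -!mulgA; congr (_ * (_ * _))%g.
    by rewrite mulgV mulg1.
  split=> //; apply: zs_inj => //; move: Ll; rewrite /l nn invgM -!mulgA.
  by rewrite (mulVKg (g n')).
- move=> c; have [s Gs ->] := mp_rcosetP c.
  (* To reach the coset of [s], move s p into [FL] by some [l]; the index is the least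
     representative of l * s, and the trivial discrepancy is absorbed by an element of [zs]. *)
  have [_ [l Ll Fl] _ _] := Agen (AG Gs Ap).
  have Gls := GM (LG Ll) Gs.
  have [n In nT] := least_rep_exists Gls; set ze := (g n * (l * s)^-1)%g in nT.
  have gn : (g n = ze * (l * s))%g by rewrite /ze -mulgA mulVg mulg1.
  have Gze : G ze by apply: GM => //; exact: GV.
  have [z zz Lz] := zs_ex (GV Gze) (mp_trivialV nT).
  have [Gz zT] := zsG zz.
  exists z, n; split => //.
    by apply/asboolP; split => //; rewrite gn hactM (mp_trivial_hact _ nT) hactM.
  apply/mp_rcoset_eq => //; first exact: GM.
  rewrite gn (_ : (_ * _)%g = l^-1 * (ze^-1 * z^-1))%g; first by apply: LM => //; exact: LV.
  by rewrite !invgM -!mulgA mulVKg.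
- move=> z n zz /[dup] Jn /asboolP[In _]; have [Gz zT] := zsG zz.
  by rewrite coset_termE ?(term_trivial _ chiU)// /selected_term ?Jn//; exact: GM.
- by move=> n /negbTE Jn; rewrite /selected_term Jn.
Qed.

End coset_sums.

(** * Integrals as integrals against [hmeas], and measurability of saturations *)

Section integrals.
Local Open Scope ereal_scope.
Variable R : realType.
Implicit Types (E : set (R * R)) (phi : R[i] -> R).

Lemma hint_hmeas (A : set R[i]) phi : A `<=` uhp -> borelC A ->
  (forall z, (0 <= phi z)%R) ->
  measurable_fun (@half_plane R) (fun p => phi (toC p)) ->
  hint A phi = \int[@hmeas R]_(p in @toC R @^-1` A) (phi (toC p))%:E.
Proof.
move=> AH mA phi0 mphi; rewrite /hint ge0_integral_density//; last 2 first.
- apply/measurable_EFinP; apply: measurable_funS mphi => //.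
    exact: measurable_half_plane.
  by move=> p /AH.
- by move=> p _; rewrite lee_fin.
by apply: eq_integral => p /set_mem /AH p0; rewrite EFinM /hweight ifT.
Qed.

Lemma integral_conull E E' (h : R * R -> \bar R) : measurable E -> measurable E' ->
  (@hmeas R).-negligible (@half_plane R `\` E') -> E `<=` @half_plane R ->
  measurable_fun E h -> (forall p, E p -> 0 <= h p) ->
  \int[@hmeas R]_(p in E) h p = \int[@hmeas R]_(p in E `&` E') h p.
Proof.
move=> mE mE' nE' EH mh h0.
have mN : measurable (@half_plane R `\` E').
  by apply: measurableD => //; exact: measurable_half_plane.
have N0 : @hmeas R (@half_plane R `\` E') = 0 by apply/negligibleP.
rewrite (@ge0_negligible_integral _ _ _ (@hmeas R) _ _ _ mN mE mh h0 N0).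
congr (integral _ _ _); apply/seteqP; split=> p [Ep h1]; split => //.
  by apply: contrapT => nE'p; apply: h1; split => //; exact: EH.
by move=> [].
Qed.

Lemma measurable_saturation (G L : set (mp R)) (g : nat -> mp R) (S : set R[i]) :
  L `<=` G -> (forall s, G s -> exists n, g n = s) -> S `<=` uhp -> borelC S ->
  borelC (mp_saturation L S).
Proof.
move=> LG gG SH mS; rewrite /borelC.
rewrite (_ : _ @^-1` _ = \bigcup_(n in [set n | L (g n)]) hact (g n) @` (@toC R @^-1` S)).
  by apply: bigcup_measurable => n _; exact: measurable_hact_image.
apply/seteqP; split=> [p [w Sw [l Ll lw]]|_ [n Ln [q Sq <-]]].
  have [n gn] := gG _ (LG _ Ll); exists n; first by rewrite /= gn.
  exists (ofC w); first by rewrite /preimage/= ofCK.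
  rewrite gn hactE; last exact: (SH _ Sw).
  by rewrite ofCK lw toCK.
exists (toC q) => //; exists (g n) => //.
by rewrite toC_hact//; exact: (SH _ Sq).
Qed.

Lemma saturation_uhp (L : set (mp R)) (S : set R[i]) : S `<=` uhp ->
  mp_saturation L S `<=` uhp.
Proof. by move=> SH z [w /SH w0 [l _ <-]]; exact: mp_act_uhp. Qed.

End integrals.

(** * The integral inequality *)

Section non_vanishing.
Variable R : realType.
Variables (G L : set (mp R)) (chi : mp R -> R[i]) (k : nat) (f : R[i] -> R[i]).
Hypotheses (Gsub : mp_subgroup G) (Lsub : mp_subgroup L) (LG : L `<=` G).
Hypothesis chiU : unitary_character G chi.
Hypothesis f_meas : borel_funC uhp f.
Hypothesis f1 : forall l z, L l -> uhp z -> slash k f l z = chi l * f z.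
Hypothesis chiZ : central_character G chi (weight R k).
Variables (FG FL : set R[i]) (A : set (R * R)).
Hypotheses (FG_borel : borelC FG) (FL_uhp : FL `<=` uhp) (FL_borel : borelC FL).
Hypotheses (mA : measurable A) (AH : A `<=` @half_plane R)
  (AN : (@hmeas R).-negligible (@half_plane R `\` A))
  (AG : forall s p, G s -> A p -> A (hact s p))
  (Agen : forall p, A p -> generic G L FG FL p).
Variable g : nat -> mp R.
Hypotheses (Gg : forall n, G (g n)) (gG : forall s, G s -> exists n, g n = s).
Variable zs : seq (mp R).
Hypotheses (zs_uniq : uniq zs)
  (zsG : forall z, z \in zs -> G z /\ mp_trivial z)
  (zs_ex : forall z, G z -> mp_trivial z -> exists2 y, y \in zs & L (z * y^-1)%g)
  (zs_inj : forall x y, x \in zs -> y \in zs -> L (x * y^-1)%g -> x = y).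

Notation H := (@half_plane R).
Notation nu := (@hmeas R).
Let F := @toC R @^-1` FL.
Let FH : F `<=` H. Proof. by move=> p /FL_uhp. Qed.
Let mH : measurable H. Proof. exact: measurable_half_plane. Qed.

Let nf p : R := cabs (normalized k f (toC p)).
Let theta := (EFin \o nf) \_ F.

Let m_theta : measurable_fun setT theta.
Proof.
apply/(measurable_restrictT _ FL_borel); apply/measurable_EFinP.
exact: measurable_funS mH FH (measurable_cabs (measurable_normalized k f_meas)).
Qed.

Let theta_ge0 p : (0 <= theta p)%E.
Proof. by rewrite /theta patchE; case: ifP => // _; rewrite lee_fin cabs_ge0. Qed.

(** On the half-plane, Im^(m/2) times the sum of the absolute values of the selected terms
    ([theta_term]); the cut of [theta] to [F] does the selecting. *)
Let sum_theta p : \bar R :=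
  (\sum_(n <oo) if `[< least_rep g n >] then theta (hact (g n) p) else 0)%E.

Let m_sum_theta : measurable_fun setT sum_theta.
Proof.
apply: ge0_emeasurable_sum => [n p _ _|n _]; first by case: ifP.
have [In|In] := pselect (least_rep g n); last by rewrite asboolF.
by rewrite asboolT//; exact: (measurableT_comp m_theta (hact_preserving (g n)).1).
Qed.

Let E := A `&` [set p | (sum_theta p < +oo)%E].

Let mE : measurable E.
Proof.
apply: measurableI => //; rewrite -[X in measurable X]setTI.
exact: emeasurable_fun_infty_o.
Qed.

Let sterm := selected_term chi k f FL g.

Let theta_term p n : H p ->
  (if `[< least_rep g n >] then theta (hact (g n) p) else 0)%E = (cabs (sterm p n) * hpow k p)%:E.
Proof.
move=> p0; rewrite /sterm /selected_term /selected.
have [In|In] := pselect (least_rep g n); last first.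
  by rewrite !asboolF ?cabs0 ?mul0r// => -[].
rewrite (asboolT In) /theta patchE.
have [Fn|Fn] := pselect (F (hact (g n) p)).
  rewrite mem_set// asboolT//= /nf toC_hact// cabs_normalized_act//.
  by rewrite (cabs_term _ _ chiU).
by rewrite memNset// asboolF ?cabs0 ?mul0r// => -[].
Qed.

Let E_summable p : E p -> cvgn (series (fun n => cabs (sterm p n))).
Proof.
move=> [Ap]; have p0 := AH Ap; rewrite /= /sum_theta.
rewrite (eq_eseriesr (g := fun n => (hpow k p)%:E * (cabs (sterm p n))%:E)%E); last first.
  by move=> n _; rewrite theta_term// muleC.
rewrite nneseriesZl; last by move=> n _; rewrite lee_fin cabs_ge0.
move=> h; apply: nnseries_is_cvg => [n|]; first exact: cabs_ge0.
rewrite ltNge leye_eq; apply/negP => /eqP e; move: h.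
by rewrite e gt0_muley ?lte_fin ?hpow_gt0// ltxx.
Qed.

Let Pn p : R := cabs (normalized k (poincare k L G chi f) (toC p)).

Let E_sum p : E p -> exists U : R[i], [/\ series (sterm p) @ \oo --> U,
  partial_sum (coset_term (G := G) (L := L) chi k f (toC p)) @ totally --> (size zs)%:R * U &
  Pn p = (size zs)%:R * cabs U * hpow k p].
Proof.
move=> Ep; have [Ap _] := Ep; have [U pU] := cvg_series_cabs (E_summable Ep).
exists U; have tot := coset_sum_selected Gsub Lsub LG chiU f1 chiZ AH AG Agen Gg gG
  zs_uniq zsG zs_ex zs_inj Ap (E_summable Ep) pU.
split=> //; rewrite /Pn normalizedE poincareE (partial_sum_lim tot) !cabsM.
rewrite (cabs_real (powR_ge0 _ _)) -(rmorph_nat (real_complex R)) cabs_real//.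
Qed.

Let zs_gt0 : (0 < size zs)%N.
Proof.
have G1 : G 1%g by case: Gsub.
have [y yz _] := zs_ex G1 (@mp_trivial1 R).
by move: yz; case: (zs).
Qed.

Let m_sterm n : measurable_funC H (fun p => sterm p n).
Proof.
rewrite /sterm /selected_term /selected.
have [In|In] := pselect (least_rep g n); last first.
  rewrite (_ : (fun _ => _) = fun=> 0); first exact: measurable_funC_cst.
  by apply/funext => p; rewrite asboolF// => -[].
rewrite (_ : (fun _ => _) = fun p =>
    if p \in hact (g n) @^-1` F then term chi k f (g n) (toC p) else 0).
  apply: measurable_funC_if => //.
    by rewrite -[_ @^-1` _]setTI; apply: (hact_preserving (g n)).1.
  apply: measurable_funCM; first exact: measurable_funC_cst.
  exact: measurable_slash.
by apply/funext => p; congr (if _ then _ else _); apply/asboolP/idP => [[_ h]|/set_mem]; [exact: mem_set|split].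
Qed.

(** On [E] the partial sums of the selected terms converge, and [Pn] is a limit of measurable
    functions. *)
Let m_Pn : measurable_fun E Pn.
Proof.
have EH : E `<=` H by move=> p [/AH].
apply: (measurable_fun_cvg (h := fun n p => (size zs)%:R * cabs (series (sterm p) n) * hpow k p)).
  move=> n; apply: measurable_funM; last exact: measurable_hpow.
  apply: measurable_funM => //; apply: measurable_funS mH EH _.
  by apply: measurable_cabs; apply: measurable_funC_sum => i; exact: m_sterm.
move=> p Ep; have [U [pU _ ->]] := E_sum Ep.
apply: cvgM; last exact: cvg_cst.
apply: cvgM; first exact: cvg_cst.
move/cvg_cabsP : pU => pU; apply/cvgrPdist_lt => e e0; apply: filterS (pU e e0) => n.
apply: le_lt_trans; move: (series _ n) => w.
have := cabsD (w - U) U; have := cabsD (U - w) w.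
rewrite !subrK -(cabsN (U - w)) opprB ler_norml => h1 h2.
by apply/andP; split; lra.
Qed.

Let Pn_act s p : G s -> E p -> Pn (hact s p) = Pn p.
Proof.
move=> Gs /[dup] Ep [Ap _]; have p0 := AH Ap.
have [U [_ pU _]] := E_sum Ep; rewrite /Pn toC_hact//.
exact: (poincare_act Gsub Lsub LG chiU f1 Gs (p0 : uhp (toC p)) pU).
Qed.

(** Countably many translates of [FG] cover [A]. On each of them the integral of [Pn], cut to [E],
    is moved to [FG] by invariance and bounded there by the integral that vanishes. *)
Let Pn_null : qint FG uhp (fun z => cabs (normalized k (poincare k L G chi f) z)) = 0%E ->
  nu.-negligible [set p | E p /\ Pn p != 0].
Proof.
move=> P0; pose NE := (EFin \o Pn) \_ E.
have m_NE : measurable_fun setT NE.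
  by apply/(measurable_restrictT _ mE); apply/measurable_EFinP; exact: m_Pn.
have NE_ge0 p : (0 <= NE p)%E.
  by rewrite /NE patchE; case: ifP => // _; rewrite lee_fin cabs_ge0.
pose FGx := @toC R @^-1` (uhp `&` FG).
have mFGx : measurable FGx by exact: measurableI.
have NB n : nu.-negligible [set p | (hact (g n) @^-1` FGx) p /\ NE p != 0%E].
  have mB : measurable (hact (g n) @^-1` FGx).
    by rewrite -[_ @^-1` _]setTI; exact: (hact_preserving (g n)).1.
  have I0 : (\int[nu]_(p in hact (g n) @^-1` FGx) `|NE p| = 0)%E.
    under eq_integral do rewrite gee0_abs//.
    have := ge0_integral_hact (g n)^-1%g mFGx m_NE NE_ge0.
    rewrite hact_image invgK => <-; apply/eqP; rewrite eq_le; apply/andP; split; last first.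
      by apply: integral_ge0 => p _.
    rewrite -P0 /qint /hint ge0_integral_density//; last first.
      by apply: measurable_funTS; exact: (measurableT_comp m_NE (hact_preserving _).1).
    (* The larger integrand involves [poincare] on all of [FG], where it may take arbitrary
       values. *)
    apply: ge0_le_integral_nonmeasurable => p [p0 _].
      by rewrite mule_ge0// lee_fin hweight_ge0.
    rewrite EFinM /hweight ifT// lee_wpmul2r ?lee_fin ?invr_ge0 ?exprn_ge0 ?(ltW p0)//.
    rewrite /NE patchE; case: ifPn => [/set_mem Eq|_]; last by rewrite lee_fin cabs_ge0.
    by rewrite /= -(Pn_act (Gg n) Eq) hactVK.
  have /ae_eq_integral_abs := I0 => /(_ mB (measurable_funTS m_NE)).
  apply: negligibleS => p [Bp Np] /= /(_ Bp) h.
  by move/eqP : Np; apply.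
apply: negligibleS (negligible_bigcup NB) => p [Ep Pp].
have [_ _ _ [s Gs Fs]] := Agen Ep.1; have [n gn] := gG Gs.
have p0 := AH Ep.1.
exists n => //; split.
  rewrite /preimage/= gn; split => //.
  exact: (hact_half_plane s p0).
by rewrite /NE patchE mem_set//= eqe.
Qed.

(** * Comparison of the two integrals through a set of orbit representatives *)

Section orbit_representatives.
Variable Sx : set (R * R).
Hypotheses (mSx : measurable Sx) (SxA : Sx `<=` A)
  (Sinj : forall s p q, G s -> Sx p -> Sx q -> hact s p = q -> p = q).

Let GM s t : G s -> G t -> G (s * t)%g. Proof. by case: Gsub => _ h _; exact: h. Qed.
Let GV s : G s -> G s^-1%g. Proof. by case: Gsub => _ _; exact. Qed.

Let S_free s p : G s -> Sx p -> Sx (hact s p) -> mp_trivial s.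
Proof.
move=> Gs Sp Ssp; have [free _ _ _] := Agen (SxA Sp).
by apply: free => //; apply/esym; exact: (Sinj Gs Sp Ssp).
Qed.

(** The quotient of [g m] and [g n] maps a point of [Sx] into [Sx], hence acts trivially; being
    central, it is also the quotient on the other side. *)
Let S_disjoint n m p q : least_rep g n -> least_rep g m -> Sx p -> Sx q ->
  hact (g n) p = hact (g m) q -> n = m.
Proof.
move=> In Im Sp Sq e.
have qE : hact ((g m)^-1 * g n)%g p = q by rewrite hactM e hactK.
have T : mp_trivial ((g m)^-1 * g n)%g.
  by apply: (@S_free _ p) => //; [apply: GM => //; exact: GV|rewrite qE].
apply: (least_rep_inj In Im).
have -> : (g n * (g m)^-1 = (g m)^-1 * g n)%g; last by [].
have gnE : (g n = g m * ((g m)^-1 * g n))%g by rewrite mulVKg.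
by rewrite {1}gnE -(mp_trivialC (g m) T) mulgK.
Qed.

Hypothesis f_summable : (\int[nu]_(p in F) (nf p)%:E < +oo)%E.

Let S_ae_E : nu.-negligible (Sx `\` E).
Proof.
have mf : measurable_fun Sx sum_theta by exact: measurable_funTS.
have sum_ge0 p : (0 <= sum_theta p)%E by apply: nneseries_ge0 => n _ _; case: ifP.
have fin : (\int[nu]_(p in Sx) `|sum_theta p| < +oo)%E.
  under eq_integral do rewrite gee0_abs//.
  rewrite /sum_theta (unfolding mSx m_theta theta_ge0); last exact: S_disjoint.
  apply: le_lt_trans f_summable; rewrite [leRHS]integral_mkcond.
  apply: ge0_subset_integral => //.
  by apply: bigcup_measurable => n _; exact: measurable_hact_image.
have /integrable_ae : nu.-integrable Sx sum_theta by apply/integrableP.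
move=> /(_ mSx); apply: negligibleS => p [Sp nE] /= /(_ Sp) h; apply: nE.
by split; [exact: SxA|rewrite /= ltey_eq h].
Qed.

Variable rho : R[i] -> R.
Hypotheses (rho_ge0 : forall z, 0 <= rho z) (rho_borel : borel_funCR rho)
  (rho0 : rho 0 = 0) (rho_abs : forall z, rho z = rho `|z|)
  (rho_sum : forall u : nat -> R[i],
     (\sum_(0 <= n <oo) (cabs (u n))%:E < +oo)%E ->
     ((rho (lim (series u @ \oo)))%:E <= \sum_(0 <= n <oo) (rho (u n))%:E)%E).

Let ps p : \bar R := (rho (normalized k f (toC p)))%:E.
Let ps_ge0 p : (0 <= ps p)%E. Proof. by rewrite lee_fin. Qed.

Let m_ps D : measurable D -> D `<=` H -> measurable_fun D ps.
Proof.
move=> mD DH; apply/measurable_EFinP.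
exact: measurable_funS mH DH (measurable_comp_normalized k f_meas rho_borel).
Qed.

Let rho_cabs z w : cabs z = cabs w -> rho z = rho w.
Proof. by move=> zw; rewrite rho_abs -cabsE zw cabsE -rho_abs. Qed.

Let ps_L l p : L l -> H p -> ps (hact l p) = ps p.
Proof.
move=> Ll p0; congr (_%:E); apply: rho_cabs.
rewrite toC_hact// cabs_normalized_act// f1// normalizedE !cabsM.
have -> : cabs (chi l) = 1 by apply: (@complexI R); rewrite cabsE chiU.2//; exact: LG.
by rewrite mul1r (cabs_real (powR_ge0 _ _)).
Qed.

(** The indices whose class in Lambda Z(Gamma) \ Gamma is that of 1. *)
Let inL n := exists2 l, L l & mp_trivial (g n * l^-1)%g.

Let ps_le p : E p -> Pn p = 0 ->
  (ps p <= \sum_(n <oo) if `[< least_rep g n /\ ~ inL n >] then (ps \_ F) (hact (g n) p) else 0)%E.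
Proof.
move=> Ep P0; have [Ap sE] := Ep; have p0 := AH Ap.
have [U [pU _ PU]] := E_sum Ep.
have U0 : U = 0.
  apply/eqP; rewrite -cabs_eq0; move/eqP : PU; rewrite P0 eq_sym !mulf_eq0.
  by rewrite pnatr_eq0 gtn_eqF// (gt_eqF (hpow_gt0 k p0)) orbF.
have [_ [l Ll Fl] _ _] := Agen Ap.
(* [n0] is the index selected at p in the class of 1: up to a trivial element it is the [l] moving p
   into [FL], so its term is f(p) itself. *)
have [n0 In0 n0T] := least_rep_exists gG (LG Ll).
have g0 : (g n0 = (g n0 * l^-1) * l)%g by rewrite mulgVK.
have hl n l' : mp_trivial (g n * l'^-1)%g -> hact (g n) p = hact l' p.
  by move=> nT; rewrite -[g n](mulgVK l') hactM (mp_trivial_hact _ nT).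
have G1 : G 1%g by case: Gsub.
have z0 : uhp (toC p) by exact: p0.
have tn0 : sterm p n0 = f (toC p).
  rewrite /sterm /selected_term /selected asboolT; last by split => //; rewrite (hl _ _ n0T).
  rewrite g0 (term_trivial _ chiU)//; [|by apply: GM => //; apply: GV; exact: LG|exact: LG].
  rewrite -[l]mulg1 (term_mull LG chiU)// /term f1//; last by case: Lsub.
  by rewrite mulrA (chi_conjK chiU)// mul1r.
have uniq_n0 n : inL n -> selected FL g p n -> n = n0.
  move=> [l' Ll' nT] /asboolP[In Fn]; apply: (least_rep_inj In In0).
  have [_ _ Lfree _] := Agen (AG (LG Ll) Ap).
  have T : mp_trivial (l' * l^-1)%g.
    apply: Lfree => //; first by case: Lsub => _ LM LV; apply: LM => //; exact: LV.
    by rewrite -hactM mulgVK -(hl _ _ nT).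
  rewrite (_ : (_ * _)%g = (g n * l'^-1) * (l' * l^-1) * (g n0 * l^-1)^-1)%g.
    by apply: mp_trivialM; [exact: mp_trivialM|exact: mp_trivialV].
  by rewrite invgM invgK -!mulgA !mulKg.
pose hp : R[i] := (hpow k p)%:C.
have chp : cabs hp = hpow k p by rewrite cabs_real// powR_ge0.
(* The selected terms sum to 0 and only the one at [n0] lies in the class of 1, so [v] sums to f(p)
   Im(p)^(m/2). *)
pose v n := if `[< inL n >] then 0 else - (sterm p n * hp).
have vE n : v n = (if n == n0 then f (toC p) * hp else 0) - sterm p n * hp.
  rewrite /v; case: asboolP => nL.
    case: eqP => [->|nn0]; first by rewrite tn0 subrr.
    rewrite /sterm /selected_term; case: ifP => [/(uniq_n0 n nL)//|_].
    by rewrite mul0r subr0.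
  case: eqP => [nn0|_]; last by rewrite sub0r.
  by exfalso; apply: nL; rewrite nn0; exists l.
have vlim : series v @ \oo --> normalized k f (toC p).
  apply/cvg_cabsP => e e0; have hp0 := hpow_gt0 k p0.
  move/cvg_cabsP : pU => /(_ _ (divr_gt0 e0 hp0)) [N _ hN].
  exists (maxn N n0.+1) => // n /=; rewrite geq_max => /andP[Nn n0n].
  have -> : series v n - normalized k f (toC p) = - ((series (sterm p) n - U) * hp).
    rewrite U0 subr0 normalizedE /series/=; under eq_bigr do rewrite vE.
    rewrite sumrB -mulr_suml -big_mkcond/= big_mkord.
    rewrite (big_pred1 (Ordinal n0n)) => [|i]; last by [].
    by rewrite addrAC subrr sub0r.
  by rewrite cabsN cabsM chp -ltr_pdivlMr//; exact: hN.
have vsum : (\sum_(0 <= n <oo) (cabs (v n))%:E < +oo)%E.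
  apply: le_lt_trans sE; apply: lee_nneseries => [n _ _|n _]; first by rewrite lee_fin cabs_ge0.
  rewrite theta_term// lee_fin /v; case: ifP => _.
    by rewrite cabs0 mulr_ge0 ?cabs_ge0// powR_ge0.
  by rewrite cabsN cabsM chp.
have := rho_sum vsum; rewrite (cvg_lim _ vlim); last exact: norm_hausdorff.
move=> h; apply: le_trans h _; rewrite le_eqVlt; apply/orP; left; apply/eqP.
(* The zeros of [v] contribute nothing by rho(0) = 0; a selected term has the modulus of the
   normalized f at the moved point, and [rho] sees only the modulus. *)
apply: eq_eseriesr => n _; rewrite /v.
have [nL|nL] := pselect (inL n); first by rewrite asboolT// asboolF ?rho0// => -[].
rewrite (asboolF nL) /sterm /selected_term /selected.
have [In|In] := pselect (least_rep g n); last first.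
  by rewrite !asboolF ?mul0r ?oppr0 ?rho0// => -[].
rewrite patchE [in RHS]asboolT//.
have [Fn|Fn] := pselect (F (hact (g n) p)); last first.
  by rewrite memNset// asboolF ?mul0r ?oppr0 ?rho0// => -[].
rewrite mem_set// asboolT//; congr (_%:E); apply: rho_cabs.
rewrite cabsN cabsM chp toC_hact// cabs_normalized_act//.
by rewrite (cabs_term _ _ chiU).
Qed.

(** [SL] stands for the whole set Lambda.S, while [Sx] is only the generic part of S; their relation
    is required at generic points. *)
Variable SL : set (R * R).
Hypotheses (mSL : measurable SL) (SLH : SL `<=` H)
  (SLP : forall p, A p -> SL p <-> exists2 l, L l & Sx (hact l p)).

Let mF : measurable F. Proof. exact: FL_borel. Qed.
Let SxH : Sx `<=` H. Proof. by move=> p /SxA/AH. Qed.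

Let m_ps_patch D : measurable D -> D `<=` H -> measurable_fun setT (ps \_ D).
Proof. by move=> mD DH; apply/(measurable_restrictT _ mD); exact: m_ps. Qed.

Let ps_patch_ge0 D p : (0 <= (ps \_ D) p)%E.
Proof. by rewrite patchE; case: ifP. Qed.

(** A generic point of [SL] in [F] is moved into [Sx] by Lambda without changing [ps]. Since [F] is
    a fundamental domain for Lambda, the translates of its generic part by distinct classes are
    disjoint, so unfolding applies. *)
Let integral_saturation_le :
  (\int[nu]_(p in SL `&` F) ps p <= \int[nu]_(p in Sx) ps p)%E.
Proof.
have mSLF : measurable (SL `&` F) by exact: measurableI.
have SLFH : SL `&` F `<=` H by move=> p [/SLH].
rewrite (integral_conull mSLF mA AN SLFH (m_ps mSLF SLFH))//.
(* The translates are taken by the inverses of the [g n]: a coincidence then gives directly that g n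
   * (g m)^-1 is trivial, as [least_rep_inj] asks. *)
pose D := [set n | least_rep g n /\ inL n].
have mFA : measurable (F `&` A) by exact: measurableI.
have Dinj n m p q : D n -> D m -> (F `&` A) p -> (F `&` A) q ->
    hact (g n)^-1%g p = hact (g m)^-1%g q -> n = m.
  move=> [In [l Ll nT]] [Im [l' Ll' mT]] [Fp Ap] [Fq Aq] e.
  have gl j s r : mp_trivial (g j * s^-1)%g -> hact (g j)^-1%g r = hact s^-1%g r.
    move=> jT; rewrite -[g j](mulgVK s) invgM hactM.
    by rewrite (mp_trivial_hact _ (mp_trivialV jT)).
  have T : mp_trivial (l' * l^-1)%g.
    have [_ _ Lfree _] := Agen Ap; apply: Lfree => //.
      by case: Lsub => _ LM LV; apply: LM => //; exact: LV.
    by rewrite hactM -(gl _ _ _ nT) e (gl _ _ _ mT) hactVK.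
  apply: (least_rep_inj In Im).
  rewrite (_ : (_ * _)%g = (g n * l^-1) * (l' * l^-1)^-1 * (g m * l'^-1)^-1)%g.
    by apply: mp_trivialM; [apply: mp_trivialM => //|]; exact: mp_trivialV.
  by rewrite !invgM !invgK -!mulgA !mulKg.
have := unfolding mFA (m_ps_patch mSx SxH) (ps_patch_ge0 Sx) Dinj.
move=> unf; apply: (@le_trans _ _ (\int[nu]_(p in F `&` A)
    (\sum_(n <oo) if `[< D n >] then (ps \_ Sx) (hact (g n)^-1%g p) else 0))%E); last first.
  rewrite unf [leRHS]integral_mkcond; apply: ge0_subset_integral => //.
    by apply: bigcup_measurable => n _; exact: measurable_hact_image.
  exact: m_ps_patch.
rewrite -setIA setIC integral_mkcondr.
apply: ge0_le_integral_nonmeasurable => p [Fp Ap] //.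
have sge0 n : (0 <= if `[< D n >] then (ps \_ Sx) (hact (g n)^-1%g p) else 0)%E by case: ifP.
rewrite patchE; case: ifPn => [/set_mem SLp|_]; last exact: nneseries_ge0.
have [l Ll Sl] := (SLP Ap).1 SLp.
have Ll' : L l^-1%g by case: Lsub => _ _; exact.
have [n In nT] := least_rep_exists gG (LG Ll').
have Dn : D n by split => //; exists l^-1%g.
have nl : hact (g n)^-1%g p = hact l p.
  rewrite -[g n](mulgVK l^-1%g) invgM hactM.
  by rewrite (mp_trivial_hact _ (mp_trivialV nT)) invgK.
(* Of the series only the n-th term is wanted; it is the last one of the partial sum of length
   n.+1. *)
apply: le_trans (nneseries_lim_ge n.+1 (fun i _ _ => sge0 i)).
rewrite big_mkord big_ord_recr/= asboolT// nl patchE mem_set// ps_L//; last exact: AH.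
by rewrite leeDr// sume_ge0.
Qed.

Hypothesis P_zero :
  qint FG uhp (fun z => cabs (normalized k (poincare k L G chi f) z)) = 0%E.

(** The pointwise bound [ps_le] is integrated over [Sx] and unfolded; the translates that occur are
    disjoint and avoid [SL]. *)
Let integral_representatives_le :
  (\int[nu]_(p in Sx) ps p <= \int[nu]_(p in (H `\` SL) `&` F) ps p)%E.
Proof.
pose D := [set n | least_rep g n /\ ~ inL n].
have Dinj n m p q : D n -> D m -> Sx p -> Sx q -> hact (g n) p = hact (g m) q -> n = m.
  by move=> [In _] [Im _]; exact: S_disjoint.
have m_psF := m_ps_patch mF FH.
have unf := unfolding mSx m_psF (ps_patch_ge0 F) Dinj.
pose sumD p := (\sum_(n <oo) if `[< D n >] then (ps \_ F) (hact (g n) p) else 0)%E.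
have sge0 n p : (0 <= if `[< D n >] then (ps \_ F) (hact (g n) p) else 0)%E by case: ifP.
apply: (@le_trans _ _ (\int[nu]_(p in Sx) sumD p)%E).
  apply: ae_ge0_le_integral => //.
  - exact: m_ps.
  - by move=> p _; exact: nneseries_ge0.
  - apply: measurable_funTS; apply: ge0_emeasurable_sum => // n _.
    have [Dn|Dn] := pselect (D n); last by rewrite asboolF.
    by rewrite asboolT//; exact: (measurableT_comp m_psF (hact_preserving (g n)).1).
  - apply: negligibleS (negligibleU S_ae_E (Pn_null P_zero)) => p /= h.
    have [Sp|nSp] := pselect (Sx p); last by exfalso; apply: h.
    have [Ep|nEp] := pselect (E p); last by left.
    right; split => //; apply/eqP => P0; apply: h => _; exact: ps_le.
rewrite unf; set W := \bigcup_(n in D) _.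
have mW : measurable W by apply: bigcup_measurable => n _; exact: measurable_hact_image.
have mHS : measurable ((H `\` SL) `&` F) by apply: measurableI => //; exact: measurableD.
rewrite -integral_mkcondr; apply: ge0_subset_integral => //.
- exact: measurableI.
- by apply: m_ps => // p [[]].
move=> p [[n [In nL] [q Sq qp]] Fp]; have Aq := SxA Sq.
have Ap : A p by rewrite -qp; exact: AG.
split=> //; split; first exact: FH.
(* If g n q were in [SL], some l * g n would map q into [Sx], hence act trivially, and [g n] would
   lie in the class of 1. *)
move=> /(SLP Ap)[l Ll]; rewrite -qp -hactM => Slq; apply: nL.
have Gln := GM (LG Ll) (Gg n).
have T := S_free Gln Sq Slq.
exists l^-1%g; first by case: Lsub => _ _; exact.
rewrite invgK (_ : (g n * l = l^-1 * (l * g n) * l)%g); last by rewrite mulKg.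
by rewrite -(mp_trivialC l^-1%g T) mulgVK.
Qed.

Lemma integral_saturation_le_compl :
  (\int[nu]_(p in SL `&` F) (rho (normalized k f (toC p)))%:E <=
   \int[nu]_(p in (H `\` SL) `&` F) (rho (normalized k f (toC p)))%:E)%E.
Proof. exact: le_trans integral_saturation_le integral_representatives_le. Qed.

End orbit_representatives.

End non_vanishing.

Theorem theorem4p5 (R : realType) (Gamma Lambda : set (mp R))
    (chi : mp R -> R[i]) (k : nat) (f : R[i] -> R[i])
    (FGamma FLambda : set R[i])
    (Gamma_sub : mp_subgroup Gamma) (Gamma_discr : mp_discrete Gamma)
    (Lambda_sub : mp_subgroup Lambda) (Lambda_Gamma : Lambda `<=` Gamma)
    (chi_unitary : unitary_character Gamma chi)
    (f_meas : borel_funC (uhp) f)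
    (FGamma_fund : fundamental_domain Gamma FGamma)
    (FLambda_fund : fundamental_domain Lambda FLambda)
    (f1 : forall l z, Lambda l -> uhp z -> slash k f l z = chi l * f z)
    (f2 : (qint FLambda (uhp)
             (fun z => cabs (normalized k f z)) < +oo)%E)
    (chi_center : central_character Gamma chi (weight R k)) :
  (exists S : set R[i],
    [/\ S `<=` uhp, borelC S,
        (forall z1 z2, S z1 -> S z2 -> z1 <> z2 ->
           mp_orbit Gamma z1 <> mp_orbit Gamma z2) &
        exists rho : R[i] -> R,
          [/\ (forall z, 0 <= rho z) /\ borel_funCR rho,
              rho 0 = 0,
              (forall z, rho z = rho `|z|),
              (forall u : nat -> R[i],
                 (\sum_(0 <= n <oo) (cabs (u n))%:E < +oo)%E ->
                 ((rho (lim (series u @ \oo)))%:E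
                    <= \sum_(0 <= n <oo) (rho (u n))%:E)%E) &
              (qint FLambda (mp_saturation Lambda S)
                 (fun z => rho (normalized k f z))
               > qint FLambda (uhp `\` mp_saturation Lambda S)
                 (fun z => rho (normalized k f z)))%E]]) ->
  (0 < qint FGamma (uhp)
         (fun z => cabs (normalized k (poincare k Lambda Gamma chi f) z)))%E.
Proof.
move=> [S [SH S_borel S1 [rho [[rho_ge0 rho_borel] rho0 rho_abs rho_sum S2]]]].
rewrite lt_neqAle; apply/andP; split; last first.
  by apply: integral_ge0 => p [p0 _]; rewrite lee_fin mulr_ge0 ?cabs_ge0// invr_ge0 exprn_ge0// ltW.
apply/eqP => /esym P0; move: S2; apply/negP; rewrite -leNgt.
have [FGH FG_borel _ _] := FGamma_fund; have [FLH FL_borel _ _] := FLambda_fund.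
have [g [Gg gG]] := mp_enumeration Gamma_sub Gamma_discr.
have [zs [zs_uniq zsG zs_ex zs_inj]] :=
  trivial_representatives Gamma_sub Lambda_sub Lambda_Gamma.
have [A [mA AH AN AG Agen]] :=
  generic_points Gamma_sub Gamma_discr Lambda_sub Lambda_Gamma FGamma_fund FLambda_fund.
(* Only S is cut to generic points; its saturation is kept whole, as it appears in the integrals to
   be compared. *)
pose Sx := (@toC R @^-1` S) `&` A.
pose SL := @toC R @^-1` mp_saturation Lambda S.
have mSx : measurable Sx by exact: measurableI.
have SL_uhp := saturation_uhp (L := Lambda) SH.
have SL_borel : borelC (mp_saturation Lambda S) := measurable_saturation Lambda_Gamma gG SH S_borel.
have uhp_borel : borelC (@uhp R) by exact: measurable_half_plane.
have Sinj s p q : Gamma s -> Sx p -> Sx q -> hact s p = q -> p = q.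
  move=> Gs [Sp Ap] [Sq Aq] spq; apply: (can_inj (@toCK R)); apply: contrapT => pq.
  apply: (S1 _ _ Sp Sq pq); have [_ GM GV] := Gamma_sub.
  have spE : mp_act s (toC p) = toC q by rewrite -spq toC_hact//; exact: AH.
  have p0 : uhp (toC p) := SH _ Sp.
  apply/seteqP; split=> _ [t Gt <-].
    exists (t * s^-1)%g; first by apply: GM => //; exact: GV.
    by rewrite -spE -mp_actM// mulgVK.
  by exists (t * s)%g; [exact: GM|rewrite mp_actM// spE].
have SLP p : A p -> SL p <-> exists2 l, Lambda l & Sx (hact l p).
  move=> Ap; have p0 := AH _ Ap; split=> [/(saturation_hact Lambda_sub p0 SH)[l Ll Sl]|[l Ll [Sl _]]].
    by exists l => //; split => //; apply: AG => //; exact: Lambda_Gamma.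
  have [_ _ LV] := Lambda_sub.
  exists (toC (hact l p)) => //; exists l^-1%g; first exact: LV.
  by rewrite toC_hact// -mp_actM// mulVg mp_act1.
have m_rho := measurable_comp_normalized k f_meas rho_borel.
have m_abs := measurable_cabs (measurable_normalized k f_meas).
have f2' : (\int[@hmeas R]_(p in @toC R @^-1` FLambda) (cabs (normalized k f (toC p)))%:E < +oo)%E.
  have e := @hint_hmeas R FLambda (fun z => cabs (normalized k f z)) FLH FL_borel
    (fun z => cabs_ge0 _) m_abs.
  by move: f2; rewrite /qint setIidr// e.
have SLH : SL `<=` @half_plane R by move=> p; exact: SL_uhp.
have SxA : Sx `<=` A by move=> p [].
have le := integral_saturation_le_compl Gamma_sub Lambda_sub Lambda_Gamma
  chi_unitary f_meas f1 chi_center FG_borel FLH FL_borel mA AH AN AG Agen Gg gG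
  zs_uniq zsG zs_ex zs_inj mSx SxA Sinj f2' rho_ge0 rho_borel rho0 rho_abs rho_sum
  SL_borel SLH SLP P0.
have hintE (B : set R[i]) : B `<=` uhp -> borelC B ->
    hint (B `&` FLambda) (fun z => rho (normalized k f z)) =
    (\int[@hmeas R]_(p in @toC R @^-1` (B `&` FLambda)) (rho (normalized k f (toC p)))%:E)%E.
  move=> BH B_borel; apply: (@hint_hmeas R _ (fun z => rho (normalized k f z))) => //.
    by move=> z [/BH].
  exact: measurableI.
by rewrite /qint !hintE//; exact: measurableD.
Qed.
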